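(* Let $\lambda>0$ and $\nu\in(0,1)$, and let $$\widehat{f}_1^{\nu}(t)=\lambda^{2}t^{2\nu-1}E_{\nu,2\nu}^{2}(-\lambda t^{\nu}),\qquad t>0.$$ Then $$\widehat{f}_1^{\nu}(t)\sim\frac{\sin(\nu\pi)}{\pi}\,\frac{2\,\Gamma(\nu+1)}{\lambda t^{\nu+1}}=\frac{2\nu}{\lambda\,\Gamma(1-\nu)\,t^{\nu+1}}\quad\text{as } t\to\infty,$$ so that the mean $\int_0^\infty t\,\widehat f_1^\nu(t)\,dt$ is infinite, and $$\widehat{f}_1^{\nu}(t)\sim\frac{\lambda^{2}t^{2\nu-1}}{\Gamma(2\nu)}\quad\text{as } t\to 0^{+}.$$
   Context: The generalized Mittag-Leffler function is $E_{\alpha,\beta}^{\gamma}(z)=\sum_{r=0}^{\infty}\frac{(\gamma)_r z^r}{r!\,\Gamma(\alpha r+\beta)}$ with $(\gamma)_r=\gamma(\gamma+1)\cdots(\gamma+r-1)$ for $r\ge1$ and $(\gamma)_0=1$. The function $\widehat f_1^\nu$ is the density of the interarrival times of the renewal process whose one-time distribution solves $\frac{d^{2\nu}p_k}{dt^{2\nu}}+2\lambda\frac{d^{\nu}p_k}{dt^{\nu}}=-\lambda^2(p_k-p_{k-1})$. The notation $f\sim g$ means $f/g\to1$. *)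

(* Defs.v *)
From HB Require Import structures.
From mathcomp Require Import all_boot all_order all_algebra.
From mathcomp Require Import all_classical all_reals all_analysis.

Set Implicit Arguments.
Unset Strict Implicit.
Unset Printing Implicit Defensive.

Import Order.TTheory GRing.Theory Num.Theory.
Import numFieldNormedType.Exports.

Local Open Scope classical_set_scope.
Local Open Scope ring_scope.

(* Euler's integral: this is the Gamma function for 0 < x only. *)
Definition Gamma_fun (R : realType) (x : R) : R :=
  \int[lebesgue_measure]_(t in `]0, +oo[) (t `^ (x - 1) * expR (- t)).

(* (c)_r = c (c + 1) ... (c + r - 1), with (c)_0 = 1. *)
Definition pochhammer (R : realType) (c : R) (r : nat) : R :=
  \prod_(0 <= i < r) (c + i%:R).

(* E_{a,b}^c(z); meant for real a, b > 0, so that Gamma_fun is only used at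
   positive arguments. *)
Definition mittag_leffler (R : realType) (a b c z : R) : R :=
  limn (pseries (fun r : nat =>
    pochhammer c r / (r`!%:R * Gamma_fun (a * r%:R + b))) z).

Definition interarrival_density (R : realType) (lambda nu t : R) : R :=
  lambda ^+ 2 * t `^ (2 * nu - 1) *
    mittag_leffler nu (2 * nu) 2 (- lambda * t `^ nu).

(* f / g tends to 1 along F. The library's [f ~_F g], i.e. f = g + o(g), is a
   different definition. *)
Definition asymp_equiv (R : realType) (F : set_system R) (f g : R -> R) : Prop :=
  f t / g t @[t --> F] --> (1 : R).

(* Main.v *)
Require Import Defs.
From mathcomp Require Import all_boot all_order all_algebra.
From mathcomp Require Import all_classical all_reals all_analysis.
From mathcomp Require Import measurable_realfun complex ring lra zify.
Import Order.TTheory GRing.Theory Num.Theory.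
Import numFieldNormedType.Exports.
Local Open Scope classical_set_scope.
Local Open Scope complex_scope.
Local Open Scope ring_scope.

(* Hankel's formula 1/Gamma(b) = (1/2 pi i) \int e^z z^-b dz, with a contour
   around the negative axis, turns the series of E_{nu,2nu}^2(-x) into the
   contour integral of e^z (z^nu + x)^-2, once the circle of the contour is so
   large that the expansion of (z^nu + x)^-2 in powers of x z^-nu converges.
   Since nu < 1, z^nu + x has no zero with |arg z| <= pi, so the circle can be
   shrunk to the origin, which leaves
     E_{nu,2nu}^2(-x) = (1/pi) \int_0^oo e^-r (-Im (r^nu e^{i nu pi} + x)^-2) dr.
   For large x the second factor is 2 sin(nu pi) r^nu / x^3 + O(r^{2nu} / x^4):
   this gives the behaviour at infinity, hence the infinite mean, while the
   behaviour at 0 is the continuity of a power series. Contours are moved by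
   Cauchy's theorem on sectors a <= |z| <= b, 0 <= arg z <= phi, which also
   gives the reflection formula for Gamma: a quarter turn in
   B(b) = \int_0^oo u^(b-1)/(1+u) du shows that B(b) sin(b pi) is unchanged when
   b is halved, and its limit as b tends to 0 is pi. *)

Set Implicit Arguments.
Unset Strict Implicit.
Unset Printing Implicit Defensive.

(** Complex functions enter as pairs of real functions of (r, phi), and phi is a free real number:
    for 0 <= phi <= pi the powers r^p e^{i p phi} have no cut. Hankel's formula is needed at every b
    = nu k + 2 nu, but shrinking the circle works only for b < 1, where the arc is O(a^(1-b)); there
    it amounts to the reflection formula. The case b = 1 is computed directly, and integration by
    parts on a fixed contour climbs from b to b + 1, in step with Gamma(b + 1) = b Gamma(b). Sum and
    integral are never exchanged: each partial sum of the series is one contour integral, and the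
    remainder of (1 + y)^-2, y = x z^-nu, has a closed form that is uniformly small on the contour
    as soon as a^nu = 4 x. The leading term x^-2 of (z^nu + x)^-2 is real, so it disappears from the
    imaginary part: this is why the decay is x^-3, that is t^(2 nu - 1 - 3 nu) = t^(- nu - 1) for x
    = lambda t^nu. The constant comes from \int_0^oo e^-r r^nu dr = Gamma(nu + 1). *)

Local Notation Re := complex.Re.
Local Notation Im := complex.Im.

(** * Integration on the half-line *)

Section integration_toolkit.
Context {R : realType}.
Implicit Types (f g F : R -> R) (a b t x : R).
Notation mu := (@lebesgue_measure R).

(* [measurable_itv] for the display carried by [lebesgue_measure], which is not
   syntactically the default display of [R]. *)
Lemma measurable_itvR (i : interval R) : @measurable _ (measurableTypeR R) [set` i].
Proof. exact: measurable_itv. Qed.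

Lemma is_derive_continuous f x (d : R) : is_derive x 1 f d -> {for x, continuous f}.
Proof. by move=> fx; apply: differentiable_continuous; apply/derivable1_diffP. Qed.

Lemma continuous_itvW f a b : {in `[a, b], forall x, {for x, continuous f}} ->
  {within `[a, b], continuous f}.
Proof.
move=> cf; apply: continuous_in_subspaceT => x /set_mem/=.
by move=> xab; apply: cf.
Qed.

Lemma integrable_continuous_itv f a b :
  {in `[a, b], forall x, {for x, continuous f}} ->
  mu.-integrable `[a, b] (EFin \o f).
Proof.
move=> cf; apply: continuous_compact_integrable; first exact: segment_compact.
exact: continuous_itvW.
Qed.

Lemma Rintegral_FTC f F a b : a <= b ->
  {in `[a, b], forall x, is_derive x 1 F (f x)} ->
  {in `[a, b], forall x, {for x, continuous f}} ->
  \int[mu]_(x in `[a, b]) f x = F b - F a.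
Proof.
rewrite le_eqVlt => /predU1P[<- _ _|ab dF cf].
  by rewrite set_itv1 Rintegral_set1 subrr.
have cF x : x \in `[a, b] -> {for x, continuous F}.
  by move=> xab; exact: is_derive_continuous (dF _ xab).
rewrite /Rintegral (@continuous_FTC2 _ f F)//.
- exact: continuous_itvW.
- split.
  + by move=> x /subset_itv_oo_cc xab; case: (dF _ xab).
  + by apply: cvg_at_right_filter; apply: cF; rewrite bound_itvE ltW.
  + by apply: cvg_at_left_filter; apply: cF; rewrite bound_itvE ltW.
- move=> x /subset_itv_oo_cc xab; have := dF _ xab => dFx.
  by rewrite derive1E derive_val.
Qed.

Lemma measurable_continuous_gt0 f : (forall t, 0 < t -> {for t, continuous f}) ->
  measurable_fun (`]0, +oo[%classic : set (measurableTypeR R)) f.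
Proof.
move=> cf; apply: open_continuous_measurable_fun => //.
by move=> x /set_mem/=; rewrite in_itv/= andbT; exact: cf.
Qed.

(** Dominated convergence for f cut off to [A n], with |f| as the bound; each point of D lies in
    [A n] from some n on, which gives the pointwise limit. *)
Lemma cvg_Rintegral_exhaust f (D : set (measurableTypeR R))
    (A : (set (measurableTypeR R))^nat) :
  measurable D -> mu.-integrable D (EFin \o f) ->
  (forall n, measurable (A n)) -> (forall n, A n `<=` D) ->
  (forall x, D x -> \forall n \near \oo, A n x) ->
  \int[mu]_(x in A n) f x @[n --> \oo] --> \int[mu]_(x in D) f x.
Proof.
move=> mD fD mA AD Aoo.
have /measurable_EFinP mf := measurable_int mu fD.
have -> : (fun n => \int[mu]_(x in A n) f x) =
    (fun n => \int[mu]_(x in D) (f \_ (A n)) x).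
  apply/funext => n; rewrite -Rintegral_mkcondr; congr (Rintegral _ _ _).
  by apply/esym/setIidPr/AD.
apply: fine_cvg.
rewrite fineK; last first.
  exact: integrable_fin_num fD.
apply: (@dominated_cvg _ _ _ mu _ _ (fun n => EFin \o (f \_ (A n)))
  (EFin \o f) (fun x => `|(f x)%:E|)%E) => //.
- move=> n; apply/measurable_EFinP; apply/measurable_restrict => //.
  apply: (measurable_funS mD); last exact: mf.
  by apply: subIset; left.
- move=> x Dx /=.
  apply: cvg_near_cst; near=> n.
  by rewrite patchE ifT// inE; near: n; exact: Aoo.
- exact: integrable_abse.
- move=> n x Dx /=; rewrite patchE; case: ifP => // _.
  by rewrite normr0 lee_fin.
Unshelve. all: by end_near. Qed.

Lemma cvg_Rintegral_pos f (l u : nat -> R) :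
  mu.-integrable `]0, +oo[ (EFin \o f) -> (forall n, 0 < l n) ->
  l @ \oo --> 0 -> u @ \oo --> +oo ->
  \int[mu]_(x in `[l n, u n]) f x @[n --> \oo] -->
  \int[mu]_(x in `]0, +oo[) f x.
Proof.
move=> fi l0 cl cu; apply: cvg_Rintegral_exhaust => //.
  by move=> n x /=; rewrite !in_itv/= andbT => /andP[+ _]; exact: lt_le_trans.
move=> x /=; rewrite in_itv/= andbT => x0; near=> n.
rewrite /= in_itv/=; apply/andP; split.
  by near: n; move/cvgrPdist_le : cl => /(_ x x0); apply: filterS => n;
    rewrite sub0r normrN; apply: le_trans; exact: ler_norm.
by near: n; move/cvgryPge : cu; exact.
Unshelve. all: by end_near. Qed.

Lemma Rintegral_itv_split f a b (c : R) : a <= c -> c <= b ->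
  {in `[a, b], forall x, {for x, continuous f}} ->
  \int[mu]_(x in `[a, b]) f x =
  \int[mu]_(x in `[a, c]) f x + \int[mu]_(x in `[c, b]) f x.
Proof.
move=> ac cb cf; have fi := integrable_continuous_itv cf.
apply/eqP; rewrite addrC -subr_eq; apply/eqP.
rewrite Rintegral_itvB//= ?bnd_simp//.
rewrite Rintegral_itv_obnd_cbnd//.
apply: (integrableS _ _ _ fi); [exact: measurable_itvR|exact: measurable_itvR|].
by apply: subset_itvr; rewrite bnd_simp.
Qed.

Lemma Rintegral_subst (F d G : R -> R) a b : a <= b ->
  (forall x, is_derive x 1 F (d x)) -> continuous d ->
  {in `[a, b] &, {homo F : x y / x < y}} ->
  {in `[F a, F b], forall x, {for x, continuous G}} ->
  \int[mu]_(x in `[F a, F b]) G x = \int[mu]_(x in `[a, b]) (G (F x) * d x).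
Proof.
move=> ab dF cd Fh cG.
have dE : F^`()%classic = d by apply/funext => x; rewrite derive1E; have dx := dF x; rewrite derive_val.
have cF x : {for x, continuous F} by exact: is_derive_continuous (dF x).
rewrite /Rintegral (@integration_by_substitution_increasing _ F G a b) ?dE//.
- by apply/cvg_ex; exists (d a); apply: cvg_at_right_filter; exact: cd.
- by apply/cvg_ex; exists (d b); apply: cvg_at_left_filter; exact: cd.
- split; first by move=> x _; have [] := dF x.
  + by apply: cvg_at_right_filter; exact: cF.
  + by apply: cvg_at_left_filter; exact: cF.
- exact: continuous_itvW.
Qed.

Lemma continuous_powR a x : 0 < x -> {for x, continuous (fun t : R => t `^ a)}.
Proof. by move=> x0; apply: is_derive_continuous (is_derive1_powR _ x0). Qed.

Lemma is_derive_powR_primitive a x : a != 0 -> 0 < x ->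
  is_derive x 1 (fun t : R => t `^ a / a) (x `^ (a - 1)).
Proof.
move=> a0 x0; have d := is_derive1_powR a x0.
apply: is_derive_eq; rewrite /GRing.scale/=.
by rewrite mulr0 add0r mulrA mulVf// mul1r.
Qed.

(** Monotone convergence: on each segment the integral of the nonnegative f is [F (u n) - F (l n)],
    and these numbers stay below M. *)
Lemma integrable_exhaust f F (D : set (measurableTypeR R)) (l u : nat -> R) (M : R) :
  (forall n, l n <= u n) ->
  nondecreasing_seq (fun n => `[l n, u n]%classic) ->
  D = \bigcup_n `[l n, u n]%classic ->
  (forall x, D x -> 0 <= f x) ->
  (forall x, D x -> {for x, continuous f}) ->
  (forall x, D x -> is_derive x 1 F (f x)) ->
  (forall n, F (u n) - F (l n) <= M) ->
  mu.-integrable D (EFin \o f).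
Proof.
move=> lu nd DE f0 cf dF FM.
have inD n x : x \in `[l n, u n] -> D x by move=> xn; rewrite DE; exists n.
have icf n := @integrable_continuous_itv f (l n) (u n)
  (fun x xn => cf x (inD n x xn)).
have mfn n : measurable_fun (`[l n, u n]%classic : set (measurableTypeR R)) (EFin \o f) := measurable_int mu (icf n).
have mf : measurable_fun D (EFin \o f).
  by rewrite DE; apply/measurable_fun_bigcup.
apply/integrableP; split => //.
have -> : (\int[mu]_(x in D) `|(EFin \o f) x| = \int[mu]_(x in D) (EFin \o f) x)%E.
  by apply: eq_integral => x /set_mem Dx /=; rewrite ger0_norm// f0.
rewrite DE.
have C := @ge0_nondecreasing_set_cvg_integral _ (measurableTypeR R) R _ (EFin \o f) mu nd
  (fun _ => measurable_itvR _) mfn (fun n x xn => f0 x (inD n x xn)).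
apply: (@le_lt_trans _ _ M%:E); last exact: ltry.
rewrite -(cvg_lim _ C)//; apply: lime_le; [by apply/cvg_ex; eexists; exact: C|].
apply: nearW => n.
rewrite -(fineK (integrable_fin_num (measurable_itvR _) (icf n))) lee_fin.
rewrite -[leLHS]/(\int[mu]_(x in _) f x) (@Rintegral_FTC _ F)//.
  by move=> x /inD; exact: dF.
by move=> x /inD; exact: cf.
Qed.

Lemma integrable_powR01 a : 0 < a ->
  mu.-integrable `]0, 1] (EFin \o (fun t => t `^ (a - 1))).
Proof.
move=> a0; apply: (@integrable_exhaust _ (fun t => t `^ a / a) _
  (fun n => n.+1%:R^-1) (fun=> 1) a^-1).
- by move=> n; rewrite invf_le1// ler1n.
- move=> m n mn; apply/subsetPset => x /=; rewrite !in_itv/= => /andP[mx ->].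
  by rewrite andbT (le_trans _ mx)// lef_pV2 ?posrE// ler_nat ltnS.
- apply/seteqP; split => x /=; last first.
    move=> [n _] /=; rewrite !in_itv/= => /andP[+ ->]; rewrite andbT.
    by apply: lt_le_trans; rewrite invr_gt0.
  rewrite in_itv/= => /andP[x0 x1]; exists (Num.truncn x^-1) => //=.
  rewrite in_itv/= x1 andbT -[leRHS]invrK lef_pV2 ?posrE ?invr_gt0//.
  by rewrite ltW// truncnS_gt.
- by move=> x _; exact: powR_ge0.
- by move=> x /=; rewrite in_itv/= => /andP[x0 _]; exact: continuous_powR.
- move=> x /=; rewrite in_itv/= => /andP[x0 _].
  by apply: is_derive_powR_primitive => //; rewrite gt_eqF.
- move=> n; rewrite powR1 mul1r lerBlDr lerDl.
  by rewrite mulr_ge0 ?powR_ge0// invr_ge0 ltW.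
Qed.

Lemma integrable_powR1y a : 0 < a ->
  mu.-integrable `[1, +oo[ (EFin \o (fun t => t `^ (- a - 1))).
Proof.
move=> a0; have p1 (x : R) : 1 <= x -> 0 < x by move=> ?; rewrite (lt_le_trans ltr01).
apply: (@integrable_exhaust _ (fun t => t `^ (- a) / - a) _
  (fun=> 1) (fun n => n.+1%:R) a^-1).
- by move=> n; rewrite ler1n.
- move=> m n mn; apply/subsetPset => x /=; rewrite !in_itv/= => /andP[-> mx].
  by rewrite (le_trans mx)// ler_nat ltnS.
- apply/seteqP; split => x /=; last first.
    by move=> [n _] /=; rewrite !in_itv/= => /andP[->].
  rewrite in_itv/= => /andP[x0 x1]; exists (Num.truncn x) => //=.
  by rewrite in_itv/= x0 ltW// truncnS_gt.
- by move=> x _; exact: powR_ge0.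
- by move=> x /=; rewrite in_itv/= andbT => /p1 x0; exact: continuous_powR.
- move=> x /=; rewrite in_itv/= andbT => /p1 x0.
  by apply: is_derive_powR_primitive => //; rewrite oppr_eq0 gt_eqF.
- move=> n; rewrite powR1 mul1r invrN mulrN opprK gerDr oppr_le0.
  by rewrite mulr_ge0 ?powR_ge0// invr_ge0 ltW.
Qed.

(** Comparison with an integrable power on each side of 1. Both of Euler's integrals, Gamma and
    Beta, are shown to converge in this way. *)
Lemma integrable_powR_bound f a b (C : R) : 0 < a -> 0 < b ->
  measurable_fun (`]0, +oo[%classic : set (measurableTypeR R)) f ->
  (forall t, 0 < t -> t <= 1 -> `|f t| <= C * t `^ (a - 1)) ->
  (forall t, 1 <= t -> `|f t| <= C * t `^ (- b - 1)) ->
  mu.-integrable `]0, +oo[ (EFin \o f).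
Proof.
move=> a0 b0 mf f01 f1y.
have C0 : 0 <= C.
  by have := f01 1 ltr01 (lexx _); rewrite powR1 mulr1; exact: le_trans.
have E : `]0, +oo[%classic = `]0, 1]%classic `|` `](1 : R), +oo[%classic.
  apply/seteqP; split => x /=; rewrite !in_itv/= !andbT.
    by move=> ->; have [|] := leP x 1; [left|right].
  by move=> [/andP[]//|]; apply: lt_trans.
have mU : measurable_fun (`]0, 1]%classic `|` `](1 : R), +oo[%classic) (EFin \o f).
  by rewrite -E; exact/measurable_EFinP.
suff [/integrableP[_ f1] /integrableP[_ f2]] :
    mu.-integrable `]0, 1] (EFin \o f) /\ mu.-integrable `]1, +oo[ (EFin \o f).
  apply/integrableP; split; first by rewrite E.
  rewrite E; apply: (@le_lt_trans _ _
      (\int[mu]_(x in `]0%R, 1%R]) `|(EFin \o f) x| +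
       \int[mu]_(x in `]1%R, +oo[) `|(EFin \o f) x|)%E).
    rewrite ge0_integral_setU//; first exact: measurableT_comp.
    apply/disj_setPS => x [] /=; rewrite !in_itv/= andbT => /andP[_ x1].
    by rewrite ltNge x1.
  exact: lte_add_pinfty.
split.
- apply: (@le_integrable _ (measurableTypeR R) R mu _ (measurable_itvR _) _ (EFin \o (fun t => C * t `^ (a - 1)))) => //.
  + apply/measurable_EFinP; apply: measurable_funS mf => //.
    by move=> x; rewrite E; left.
  + move=> x /=; rewrite in_itv/= => /andP[x0 x1].
    rewrite /= lee_fin (le_trans (f01 _ x0 x1))//.
    by rewrite ger0_norm ?mulr_ge0 ?powR_ge0.
  + have := integrableZl (measurable_itvR _) C (integrable_powR01 a0).
    by apply: eq_integrable => // x _ /=; rewrite EFinM.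
- apply: (@le_integrable _ (measurableTypeR R) R mu _ (measurable_itvR _) _ (EFin \o (fun t => C * t `^ (- b - 1)))) => //.
  + apply/measurable_EFinP; apply: measurable_funS mf => //.
    by move=> x; rewrite E; right.
  + move=> x /=; rewrite in_itv/= andbT => x1.
    rewrite /= lee_fin (le_trans (f1y _ (ltW x1)))//.
    by rewrite ger0_norm ?mulr_ge0 ?powR_ge0.
  + have S : `]1, +oo[ `<=` `[(1 : R), +oo[.
      by move=> y /=; rewrite !in_itv/= !andbT; exact: ltW.
    have := integrableZl (measurable_itvR _) C (integrableS (measurable_itvR _)
        (measurable_itvR _) S (integrable_powR1y b0)).
    by apply: eq_integrable => // x _ /=; rewrite EFinM.
Qed.

End integration_toolkit.

(** * Holomorphic functions in polar coordinates *)

Section polar_holomorphy.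
Context {R : realType}.
Implicit Types (f g : R -> R -> R[i]) (r phi p a : R) (z w : R[i]).
Notation mu := (@lebesgue_measure R).

Lemma ReD z w : Re (z + w) = Re z + Re w. Proof. by case: z; case: w. Qed.
Lemma ImD z w : Im (z + w) = Im z + Im w. Proof. by case: z; case: w. Qed.
Lemma ReM z w : Re (z * w) = Re z * Re w - Im z * Im w.
Proof. by case: z; case: w. Qed.
Lemma ImM z w : Im (z * w) = Re z * Im w + Im z * Re w.
Proof. by case: z; case: w. Qed.
Lemma ReV z : Re z^-1 = Re z / (Re z ^+ 2 + Im z ^+ 2). Proof. by case: z. Qed.
Lemma ImV z : Im z^-1 = - (Im z / (Re z ^+ 2 + Im z ^+ 2)). Proof. by case: z. Qed.
Lemma ReN z : Re (- z) = - Re z. Proof. by case: z. Qed.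
Lemma ImN z : Im (- z) = - Im z. Proof. by case: z. Qed.

(** The squared modulus, as an element of R. It is multiplicative without any square root, so bounds
    on complex factors are stated with it. *)
Definition sqnorm z := Re z ^+ 2 + Im z ^+ 2.

Lemma sqnorm_ge0 z : 0 <= sqnorm z.
Proof. by rewrite addr_ge0 ?sqr_ge0. Qed.

Lemma sqnormM z w : sqnorm (z * w) = sqnorm z * sqnorm w.
Proof. by rewrite /sqnorm ReM ImM; ring. Qed.

Lemma sqnorm_eq0 z : (sqnorm z == 0) = (z == 0).
Proof.
by rewrite /sqnorm paddr_eq0 ?sqr_ge0// !sqrf_eq0 eq_complex.
Qed.

Definition cexp z : R[i] := (expR (Re z) * cos (Im z)) +i* (expR (Re z) * sin (Im z)).

(** The power z^p at z = r e^{i phi}, continued along phi. As phi is a real number and not an angle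
    modulo 2 pi, phi = pi is an ordinary point. *)
Definition cpow p r phi : R[i] := (r `^ p * cos (p * phi)) +i* (r `^ p * sin (p * phi)).

(** Joint continuity, because the partial derivative in r has to be bounded on a whole rectangle
    before one differentiates under the integral sign. *)
Definition cont2 (u : R -> R -> R) r phi :=
  {for (r, phi), continuous (fun x : R * R => u x.1 x.2)}.

(* [f] is a function of z = r e^{i phi}, holomorphic at that point, with z f'(z) = g. *)
Record hol f g r phi : Prop := Hol {
  hol_Re_r : is_derive r 1 (fun s => Re (f s phi)) (Re (g r phi) / r) ;
  hol_Im_r : is_derive r 1 (fun s => Im (f s phi)) (Im (g r phi) / r) ;
  hol_Re_phi : is_derive phi 1 (fun s => Re (f r s)) (- Im (g r phi)) ;
  hol_Im_phi : is_derive phi 1 (fun s => Im (f r s)) (Re (g r phi)) ;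
  hol_cont_Re : cont2 (fun s t => Re (f s t)) r phi ;
  hol_cont_Im : cont2 (fun s t => Im (f s t)) r phi ;
  hol_cont_Re' : cont2 (fun s t => Re (g s t)) r phi ;
  hol_cont_Im' : cont2 (fun s t => Im (g s t)) r phi }.

Lemma cont2_eq (u v : R -> R -> R) r phi : (forall s t, v s t = u s t) ->
  cont2 u r phi -> cont2 v r phi.
Proof. by move=> vu; rewrite (_ : v = u)//; apply/funext => s; apply/funext. Qed.

Lemma cont2_comp1 (u : R -> R) r phi : {for r, continuous u} ->
  cont2 (fun s _ => u s) r phi.
Proof.
move=> cu; apply: (@continuous_comp _ _ _ (@fst R R) u); last exact: cu.
exact: cvg_fst.
Qed.

Lemma cont2_comp2 (u : R -> R) r phi : {for phi, continuous u} ->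
  cont2 (fun _ t => u t) r phi.
Proof.
move=> cu; apply: (@continuous_comp _ _ _ (@snd R R) u); last exact: cu.
exact: cvg_snd.
Qed.

Lemma cont2_comp (v : R -> R) (u : R -> R -> R) r phi : cont2 u r phi ->
  {for u r phi, continuous v} -> cont2 (fun s t => v (u s t)) r phi.
Proof. by move=> cu cv; exact: (continuous_comp cu cv). Qed.

Lemma cont2D (u v : R -> R -> R) r phi : cont2 u r phi -> cont2 v r phi ->
  cont2 (fun s t => u s t + v s t) r phi.
Proof. by move=> cu cv; exact: (cvgD cu cv). Qed.

Lemma cont2N (u : R -> R -> R) r phi : cont2 u r phi ->
  cont2 (fun s t => - u s t) r phi.
Proof. by move=> cu; exact: (cvgN cu). Qed.

Lemma cont2M (u v : R -> R -> R) r phi : cont2 u r phi -> cont2 v r phi ->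
  cont2 (fun s t => u s t * v s t) r phi.
Proof. by move=> cu cv; exact: (cvgM cu cv). Qed.

Lemma cont2V (u : R -> R -> R) r phi : u r phi != 0 -> cont2 u r phi ->
  cont2 (fun s t => (u s t)^-1) r phi.
Proof. by move=> u0 cu; exact: (cvgV u0 cu). Qed.

Lemma cont2_cst c r phi : cont2 (fun _ _ => c) r phi.
Proof. exact: cvg_cst. Qed.

Lemma is_derive_quot (u n : R -> R) (x du dn : R) :
  is_derive x 1 u du -> is_derive x 1 n dn -> n x != 0 ->
  is_derive x 1 (fun s => u s / n s) (du / n x - u x * dn / n x ^+ 2).
Proof.
move=> dU dN n0; have dV := @is_deriveV _ n x dn 1 n0 dN.
by apply: is_derive_eq; rewrite /GRing.scale/=; field.
Qed.

Lemma is_derive_sqnorm (u v : R -> R) (x du dv : R) :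
  is_derive x 1 u du -> is_derive x 1 v dv ->
  is_derive x 1 (fun s => u s ^+ 2 + v s ^+ 2) (2 * u x * du + 2 * v x * dv).
Proof. by move=> dU dV; apply: is_derive_eq; rewrite /GRing.scale/=; ring. Qed.

Lemma hol_cst z r phi : hol (fun _ _ => z) (fun _ _ => 0) r phi.
Proof.
by split; rewrite /= ?mul0r ?oppr0; try exact: is_derive_cst; exact: cont2_cst.
Qed.

Lemma holD f f' g g' r phi : hol f f' r phi -> hol g g' r phi ->
  hol (fun s t => f s t + g s t) (fun s t => f' s t + g' s t) r phi.
Proof.
move=> [a1 a2 a3 a4 a5 a6 a7 a8] [b1 b2 b3 b4 b5 b6 b7 b8]; split.
- under eq_fun do rewrite ReD.
  by apply: is_derive_eq; rewrite ReD mulrDl.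
- under eq_fun do rewrite ImD.
  by apply: is_derive_eq; rewrite ImD mulrDl.
- under eq_fun do rewrite ReD.
  by apply: is_derive_eq; rewrite ImD opprD.
- under eq_fun do rewrite ImD.
  by apply: is_derive_eq; rewrite ReD.
- by apply: (cont2_eq (fun s t => ReD _ _)); exact: cont2D.
- by apply: (cont2_eq (fun s t => ImD _ _)); exact: cont2D.
- by apply: (cont2_eq (fun s t => ReD _ _)); exact: cont2D.
- by apply: (cont2_eq (fun s t => ImD _ _)); exact: cont2D.
Qed.

Lemma cont2_ReM f g r phi :
  cont2 (fun s t => Re (f s t)) r phi -> cont2 (fun s t => Im (f s t)) r phi ->
  cont2 (fun s t => Re (g s t)) r phi -> cont2 (fun s t => Im (g s t)) r phi ->
  cont2 (fun s t => Re (f s t * g s t)) r phi.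
Proof.
move=> a b c d; apply: (cont2_eq (fun s t => ReM _ _)).
by apply: cont2D; [exact: cont2M|apply: cont2N; exact: cont2M].
Qed.

Lemma cont2_ImM f g r phi :
  cont2 (fun s t => Re (f s t)) r phi -> cont2 (fun s t => Im (f s t)) r phi ->
  cont2 (fun s t => Re (g s t)) r phi -> cont2 (fun s t => Im (g s t)) r phi ->
  cont2 (fun s t => Im (f s t * g s t)) r phi.
Proof.
move=> a b c d; apply: (cont2_eq (fun s t => ImM _ _)).
by apply: cont2D; exact: cont2M.
Qed.

Lemma holM f f' g g' r phi : hol f f' r phi -> hol g g' r phi ->
  hol (fun s t => f s t * g s t)
      (fun s t => f' s t * g s t + f s t * g' s t) r phi.
Proof.
move=> [a1 a2 a3 a4 a5 a6 a7 a8] [b1 b2 b3 b4 b5 b6 b7 b8]; split.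
- under eq_fun do rewrite ReM.
  by apply: is_derive_eq; rewrite /GRing.scale/= ReD !ReM; ring.
- under eq_fun do rewrite ImM.
  by apply: is_derive_eq; rewrite /GRing.scale/= ImD !ImM; ring.
- under eq_fun do rewrite ReM.
  by apply: is_derive_eq; rewrite /GRing.scale/= ImD !ImM; ring.
- under eq_fun do rewrite ImM.
  by apply: is_derive_eq; rewrite /GRing.scale/= ReD !ReM; ring.
- exact: cont2_ReM.
- exact: cont2_ImM.
- apply: (cont2_eq (fun s t => ReD _ _)).
  by apply: cont2D; exact: cont2_ReM.
- apply: (cont2_eq (fun s t => ImD _ _)).
  by apply: cont2D; exact: cont2_ImM.
Qed.

Lemma holV f f' r phi : f r phi != 0 -> hol f f' r phi ->
  hol (fun s t => (f s t)^-1)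
      (fun s t => - (f' s t * ((f s t)^-1 * (f s t)^-1))) r phi.
Proof.
rewrite -sqnorm_eq0 => f0 [a1 a2 a3 a4 a5 a6 a7 a8].
have cn : cont2 (fun s t => Re (f s t) ^+ 2 + Im (f s t) ^+ 2) r phi.
  by apply: cont2D; exact: cont2M.
have cRV : cont2 (fun s t => Re (f s t)^-1) r phi.
  apply: (cont2_eq (fun s t => ReV _)).
  by apply: cont2M => //; exact: cont2V.
have cIV : cont2 (fun s t => Im (f s t)^-1) r phi.
  apply: (cont2_eq (fun s t => ImV _)).
  by apply: cont2N; apply: cont2M => //; exact: cont2V.
have cR2 : cont2 (fun s t => Re ((f s t)^-1 * (f s t)^-1)) r phi by exact: cont2_ReM.
have cI2 : cont2 (fun s t => Im ((f s t)^-1 * (f s t)^-1)) r phi by exact: cont2_ImM.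
move: f0; rewrite /sqnorm => f0.
split => //.
- under eq_fun do rewrite ReV.
  apply: (is_derive_eq (is_derive_quot a1 (is_derive_sqnorm a1 a2) f0)).
  (* Here r may be 0; with r^-1 generalized, [field] only asks that the squared modulus of f be
     nonzero. *)
  by rewrite ReN ReM ReM ImM ReV ImV ?fctE; move: (r^-1) => ri; field.
- under eq_fun do rewrite ImV -mulNr.
  apply: (is_derive_eq (is_derive_quot (is_deriveN a2) (is_derive_sqnorm a1 a2) f0)).
  by rewrite ImN ImM ReM ImM ReV ImV fctE; move: (r^-1) => ri; field.
- under eq_fun do rewrite ReV.
  apply: (is_derive_eq (is_derive_quot a3 (is_derive_sqnorm a3 a4) f0)).
  by rewrite ImN ImM ReM ImM ReV ImV; move: (r^-1) => ri; field.
- under eq_fun do rewrite ImV -mulNr.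
  apply: (is_derive_eq (is_derive_quot (is_deriveN a4) (is_derive_sqnorm a3 a4) f0)).
  by rewrite ReN ReM ReM ImM ReV ImV ?fctE; move: (r^-1) => ri; field.
- by apply: (cont2_eq (fun s t => ReN _)); apply: cont2N; exact: cont2_ReM.
- by apply: (cont2_eq (fun s t => ImN _)); apply: cont2N; exact: cont2_ImM.
Qed.

Lemma hol_cexp f f' r phi : hol f f' r phi ->
  hol (fun s t => cexp (f s t)) (fun s t => f' s t * cexp (f s t)) r phi.
Proof.
move=> [a1 a2 a3 a4 a5 a6 a7 a8].
have cR : cont2 (fun s t => Re (cexp (f s t))) r phi.
  by apply: cont2M; apply: cont2_comp => //; [exact: continuous_expR|exact: continuous_cos].
have cI : cont2 (fun s t => Im (cexp (f s t))) r phi.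
  by apply: cont2M; apply: cont2_comp => //; [exact: continuous_expR|exact: continuous_sin].
split => //.
- by apply: is_derive_eq; rewrite /GRing.scale/= ReM /=; ring.
- by apply: is_derive_eq; rewrite /GRing.scale/= ImM /=; ring.
- by apply: is_derive_eq; rewrite /GRing.scale/= ImM /=; ring.
- by apply: is_derive_eq; rewrite /GRing.scale/= ReM /=; ring.
- exact: cont2_ReM.
- exact: cont2_ImM.
Qed.

Lemma hol_cpow p r phi : 0 < r ->
  hol (cpow p) (fun s t => p%:C * cpow p s t) r phi.
Proof.
move=> r0.
have dp := is_derive1_powR p r0.
have cR : cont2 (fun s t => Re (cpow p s t)) r phi.
  apply: cont2M; first by apply: cont2_comp1; exact: continuous_powR.
  apply: cont2_comp; last exact: continuous_cos.
  by apply: cont2M; [exact: cont2_cst|exact: cont2_comp2].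
have cI : cont2 (fun s t => Im (cpow p s t)) r phi.
  apply: cont2M; first by apply: cont2_comp1; exact: continuous_powR.
  apply: cont2_comp; last exact: continuous_sin.
  by apply: cont2M; [exact: cont2_cst|exact: cont2_comp2].
have rp : r `^ (p - 1) = r `^ p / r.
  by rewrite powRD ?powRN ?powRr1 ?(ltW r0)//; apply/implyP; rewrite (gt_eqF r0).
split => //.
- apply: is_derive_eq; rewrite /GRing.scale/= /= rp; ring.
- by apply: is_derive_eq; rewrite /GRing.scale/= /= rp; ring.
- by apply: is_derive_eq; rewrite /GRing.scale/= /=; ring.
- by apply: is_derive_eq; rewrite /GRing.scale/= /=; ring.
- by apply: cont2_ReM => //; exact: cont2_cst.
- by apply: cont2_ImM => //; exact: cont2_cst.
Qed.

End polar_holomorphy.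

(** * Cauchy's theorem on sectors *)

Section rectangle.
Context {R : realType}.
Implicit Types (f g : R -> R -> R[i]) (r phi a b : R).
Notation mu := (@lebesgue_measure R).

Lemma cont2_bounded (u : R -> R -> R) a b c d :
  (forall s t, a <= s <= b -> c <= t <= d -> cont2 u s t) ->
  exists M, forall s t, a <= s <= b -> c <= t <= d -> `|u s t| <= M.
Proof.
move=> cu.
have cK : compact (`[a, b]%classic `*` `[c, d]%classic : set (R * R)).
  by apply: compact_setX; exact: segment_compact.
have : compact ((fun x : R * R => u x.1 x.2) @` (`[a, b]%classic `*` `[c, d]%classic)).
  apply: continuous_compact => //; apply: continuous_in_subspaceT => -[s t] /set_mem[/=].
  by rewrite !in_itv/=; exact: cu.
move=> /compact_bounded[M [_ bM]]; exists (M + 1) => s t sab tcd.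
apply: (bM (M + 1)); first by rewrite ltrDl.
by exists (s, t) => //; split; rewrite /= in_itv.
Qed.

Lemma cont2_r (u : R -> R -> R) r phi : cont2 u r phi ->
  {for r, continuous (fun s => u s phi)}.
Proof.
move=> cu; apply: (@continuous_comp _ _ _ (fun s => (s, phi)) (fun x : R * R => u x.1 x.2)).
  exact: (@cvg_pair _ _ _ (nbhs r) (nbhs r) (nbhs phi) _ _ _ id (fun=> phi)
    cvg_id (@cvg_cst _ phi _ (nbhs r) _)).
exact: cu.
Qed.

Lemma cont2_phi (u : R -> R -> R) r phi : cont2 u r phi ->
  {for phi, continuous (u r)}.
Proof.
move=> cu; apply: (@continuous_comp _ _ _ (fun s => (r, s)) (fun x : R * R => u x.1 x.2)).
  exact: (@cvg_pair _ _ _ (nbhs phi) (nbhs r) (nbhs phi) _ _ _ (fun=> r) id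
    (@cvg_cst _ r _ (nbhs phi) _) cvg_id).
exact: cu.
Qed.

(** Differentiate under the integral sign; by the Cauchy-Riemann equations d/dr Re f = Re g / r =
    (1/r) d/dphi Im f, so the integral over phi reduces to boundary values. *)
Lemma is_derive_Rintegral_arc f g phi0 r : 0 <= phi0 -> 0 < r ->
  (forall s t, 0 < s -> 0 <= t <= phi0 -> hol f g s t) ->
  is_derive r 1 (fun s => \int[mu]_(t in `[0, phi0]) Re (f s t))
    ((Im (f r phi0) - Im (f r 0)) / r).
Proof.
move=> phi0_ge0 r0 hf.
have r2 : 0 < r / 2 by rewrite divr_gt0.
(* The dominating function is a constant, by compactness of a closed sector that stays away from the
   origin. *)
have [M HM] : exists M, forall s t, r / 2 <= s <= 2 * r -> 0 <= t <= phi0 ->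
    `|Re (g s t) / s| <= M.
  apply: cont2_bounded => s t /andP[rs _] t0.
  have s0 : 0 < s by exact: lt_le_trans rs.
  apply: cont2M; first by have [] := hf _ _ s0 t0.
  by apply: cont2_comp1; apply: cvgV; [rewrite gt_eqF|exact: cvg_id].
have Ir : `]r / 2, 2 * r[%classic r.
  by rewrite /= in_itv/=; apply/andP; split; lra.
have I0 s : `]r / 2, 2 * r[%classic s -> 0 < s /\ r / 2 <= s <= 2 * r.
  rewrite /= in_itv/= => /andP[a b]; split; first exact: lt_trans a.
  by rewrite !ltW.
have intf s : `]r / 2, 2 * r[%classic s ->
    mu.-integrable `[0, phi0] (EFin \o (fun t => Re (f s t))).
  move=> /I0[s0 _]; apply: integrable_continuous_itv => t; rewrite in_itv/= => t0.
  by apply: (cont2_phi (u := fun s t => Re (f s t))); have [] := hf _ _ s0 t0.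
have B0 t : `[0, phi0]%classic t -> 0 <= t <= phi0 by rewrite /= in_itv.
have dfr s t : `]r / 2, 2 * r[%classic s -> `[0, phi0]%classic t ->
    is_derive s 1 (fun s => Re (f s t)) (Re (g s t) / s).
  by move=> /I0[s0 _] /B0 t0; have [] := hf _ _ s0 t0.
have M0 : 0 <= M.
  by have /I0[_ rr] := Ir; apply: le_trans (HM r 0 rr _); rewrite ?normr_ge0// lexx.
have dfr' s t : `]r / 2, 2 * r[%classic s -> `[0, phi0]%classic t ->
    derivable ((fun s t => Re (f s t)) ^~ t) s 1.
  by move=> Is Bt; have [] := dfr s t Is Bt.
have partialE s t : `]r / 2, 2 * r[%classic s -> `[0, phi0]%classic t ->
    partial1of2 (fun s t => Re (f s t)) s t = Re (g s t) / s.
  move=> Is Bt; rewrite /partial1of2 derive1E.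
  by have d := dfr s t Is Bt; rewrite derive_val.
have intM : mu.-integrable `[0, phi0] (EFin \o (fun=> M)).
  by apply: integrable_continuous_itv => x _; exact: cvg_cst.
have bM s t : `]r / 2, 2 * r[%classic s -> `[0, phi0]%classic t ->
    `|partial1of2 (fun s t => Re (f s t)) s t| <= M.
  by move=> Is Bt; rewrite partialE//; apply: HM; [exact: (I0 _ Is).2|exact: B0].
have L := @cvg_differentiation_under_integral R _ (measurableTypeR R) mu
  (fun s t => Re (f s t)) `[0, phi0] (measurable_itvR _) r (r / 2) (2 * r) Ir intf
  dfr' (fun=> M) (fun=> M0) intM bM.
have E : \int[mu]_(t in `[0, phi0]) partial1of2 (fun s t => Re (f s t)) r t =
    (Im (f r phi0) - Im (f r 0)) / r.
  rewrite (_ : Rintegral _ _ _ = \int[mu]_(t in `[0, phi0]) (Re (g r t) / r)).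
    rewrite (@Rintegral_FTC _ _ (fun t => Im (f r t) / r))//.
    - by rewrite mulrBl.
    - move=> t; rewrite in_itv/= => /(hf _ _ r0)[_ _ _ d _ _ _ _].
      by apply: is_derive_eq; rewrite /GRing.scale/= mulr0 add0r mulrC.
    - move=> t; rewrite in_itv/= => /(hf _ _ r0)[_ _ _ _ _ _ /cont2_phi d _].
      by apply: cvgM; [exact: d|exact: cvg_cst].
  by apply: eq_Rintegral => t /set_mem tB; exact: partialE.
rewrite E in L.
have L' : (fun h => h^-1 *: ((fun s => \int[mu]_(t in `[0, phi0]) Re (f s t)) (h *: 1 + r) -
    \int[mu]_(t in `[0, phi0]) Re (f r t))) h @[h --> 0^'] -->
    ((Im (f r phi0) - Im (f r 0)) / r : R).
  apply: cvg_trans L; apply: near_eq_cvg; apply: nearW => h.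
  by rewrite /GRing.scale/= mulr1.
by split; [apply/cvg_ex; eexists; exact: L'|exact: cvg_lim L'].
Qed.

(** This is the imaginary part of Cauchy's theorem for f(z) dz/z on the sector: dz/z is i dphi on
    the arcs, which leaves Re f, and dr/r on the sides, which leaves Im f / r. It follows by
    integrating the derivative of the arc integral in r. *)
Lemma rectangle_theorem f g phi0 a b : 0 <= phi0 -> 0 < a -> a <= b ->
  (forall s t, 0 < s -> 0 <= t <= phi0 -> hol f g s t) ->
  \int[mu]_(t in `[0, phi0]) Re (f b t) - \int[mu]_(t in `[0, phi0]) Re (f a t) =
  \int[mu]_(r in `[a, b]) ((Im (f r phi0) - Im (f r 0)) / r).
Proof.
move=> phi0_ge0 a0 ab hf.
have pos r : r \in `[a, b] -> 0 < r.
  by rewrite in_itv/= => /andP[ar _]; exact: lt_le_trans ar.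
rewrite (@Rintegral_FTC _ _ (fun s => \int[mu]_(t in `[0, phi0]) Re (f s t)))//.
  by move=> r /pos r0; exact: is_derive_Rintegral_arc hf.
move=> r /pos r0.
have [_ /is_derive_continuous c1 _ _ _ _ _ _] := hf r phi0 r0 (introT andP (conj phi0_ge0 (lexx _))).
have [_ /is_derive_continuous c2 _ _ _ _ _ _] := hf r 0 r0 (introT andP (conj (lexx _) phi0_ge0)).
apply: cvgM; first by apply: cvgB; [exact: c1|exact: c2].
by apply: cvgV; [rewrite gt_eqF|exact: cvg_id].
Qed.

End rectangle.

(** * The Gamma function and its reflection formula *)

Section gamma_function.
Context {R : realType}.
Implicit Types (x t p : R).
Notation mu := (@lebesgue_measure R).

(** One term of the exponential series suffices: (c t)^(k+1) / (k+1)! <= e^(c t), with k + 1 > |p|,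
    and t^p <= t^(k+1) because t >= 1. *)
Lemma powR_expR_bounded (c p : R) : 0 < c ->
  exists C, forall t, 1 <= t -> t `^ p * expR (- (c * t)) <= C.
Proof.
move=> c0; pose k := (Num.truncn `|p|).
exists (k.+1`!%:R / c ^+ k.+1) => t t1.
have t0 : 0 < t by exact: lt_le_trans t1.
have ct0 : 0 <= c * t by rewrite mulr_ge0 ?ltW.
rewrite expRN ler_pdivrMr ?expR_gt0//.
apply: (@le_trans _ _ (t ^+ k.+1)).
  rewrite -powR_mulrn ?(ltW t0)//; apply: ler_powR => //.
  by rewrite (le_trans (ler_norm p))// ltW// truncnS_gt.
rewrite mulrAC ler_pdivlMr ?exprn_gt0// -exprMn [t * c]mulrC.
rewrite -ler_pdivrMl ?ltr0n ?fact_gt0// [leLHS]mulrC.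
by rewrite (le_trans _ (expR_ge1Dxn k ct0))// lerDr.
Qed.

Lemma continuous_powR_expR (c x t : R) : 0 < t ->
  {for t, continuous (fun t => t `^ (x - 1) * expR (- (c * t)))}.
Proof.
move=> t0; apply: cvgM; first exact: continuous_powR.
apply: continuous_comp; last exact: continuous_expR.
by apply: cvgN; apply: cvgM; [exact: cvg_cst|exact: cvg_id].
Qed.

Lemma integrable_powR_expR (c x : R) : 0 < c -> 0 < x ->
  mu.-integrable `]0, +oo[ (EFin \o (fun t => t `^ (x - 1) * expR (- (c * t)))).
Proof.
move=> c0 x0; have [C HC] := powR_expR_bounded (x + 1) c0.
apply: (@integrable_powR_bound _ _ x 1 (Num.max 1 C)) => //.
- by apply: measurable_continuous_gt0 => t; exact: continuous_powR_expR.
- move=> t t0 t1; rewrite ger0_norm ?mulr_ge0 ?powR_ge0 ?expR_ge0//.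
  rewrite [leLHS]mulrC ler_wpM2r ?powR_ge0// le_max expRN invf_le1 ?expR_gt0//.
  by rewrite -expR0 ler_expR mulr_ge0 ?(ltW c0) ?(ltW t0).
- move=> t t1; rewrite ger0_norm ?mulr_ge0 ?powR_ge0 ?expR_ge0//.
  have t0 : 0 < t by exact: lt_le_trans t1.
  (* The factor t^-2 is set aside for integrability at infinity; the remaining t^(x+1) is absorbed
     by the exponential, which is why C was taken for the exponent x + 1. *)
  rewrite (_ : x - 1 = (x + 1) + (- 1 - 1)); last by ring.
  rewrite powRD; last by apply/implyP; rewrite (gt_eqF t0).
  by rewrite mulrAC ler_wpM2r ?powR_ge0// le_max HC// orbT.
Qed.

Definition gamma_integrand x t := t `^ (x - 1) * expR (- t).

Lemma gamma_integrandE x : gamma_integrand x = (fun t => t `^ (x - 1) * expR (- (1 * t))).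
Proof. by apply/funext => t; rewrite mul1r. Qed.

Lemma continuous_gamma_integrand x t : 0 < t -> {for t, continuous (gamma_integrand x)}.
Proof. by rewrite gamma_integrandE; exact: continuous_powR_expR. Qed.

Lemma integrable_gamma x : 0 < x ->
  mu.-integrable `]0, +oo[ (EFin \o gamma_integrand x).
Proof. by rewrite gamma_integrandE; exact: integrable_powR_expR. Qed.

Lemma harmonic_cvg0r : (fun n => n.+1%:R^-1 : R) @ \oo --> (0 : R)^'+.
Proof.
move=> P [e /= e0 Pe]; suff : \forall n \near \oo, P n.+1%:R^-1 by [].
near=> n; apply: Pe; last by rewrite /= invr_gt0.
rewrite /= sub0r normrN ger0_norm ?invr_ge0// -[ltRHS]invrK.
rewrite ltf_pV2 ?posrE ?invr_gt0// (lt_le_trans (truncnS_gt _))// ler_nat ltnS.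
by near: n; exact: nbhs_infty_ge.
Unshelve. all: by end_near. Qed.

Lemma cvg_powR_harmonic p : 0 < p -> (n.+1%:R^-1 : R) `^ p @[n --> \oo] --> 0.
Proof. by move=> p0; exact: (cvg_comp _ _ harmonic_cvg0r (powR_cvg0 p0)). Qed.

Lemma cvg_natS : (n.+1%:R : R) @[n --> \oo] --> +oo.
Proof.
apply/cvgryPge => M; near=> n.
rewrite (le_trans (ler_norm M))// (le_trans (ltW (truncnS_gt _)))// ler_nat ltnS.
by near: n; exact: nbhs_infty_ge.
Unshelve. all: by end_near. Qed.

(** The fundamental theorem of calculus, substitution and Cauchy's theorem are used on segments;
    this passes their conclusions to the half-line. *)
Lemma cvg_Rintegral_invn (f : R -> R) : mu.-integrable `]0, +oo[ (EFin \o f) ->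
  \int[mu]_(x in `[n.+1%:R^-1, n.+1%:R]) f x @[n --> \oo] -->
  \int[mu]_(x in `]0, +oo[) f x.
Proof.
move=> fi; apply: (cvg_Rintegral_pos fi); last exact: cvg_natS.
  by move=> n; rewrite invr_gt0.
exact: cvg_harmonic.
Qed.

Lemma powRV t p : 0 < t -> t^-1 `^ p = t `^ (- p).
Proof. by move=> t0; rewrite -powR_inv1 ?(ltW t0)// -powRrM mulN1r. Qed.

(** Integration by parts: x t^(x-1) e^-t - t^x e^-t is the derivative of t^x e^-t, which vanishes at
    both ends of the half-line. *)
Lemma Gamma_funS x : 0 < x -> Gamma_fun (x + 1) = x * Gamma_fun x.
Proof.
move=> x0.
have x10 : 0 < x + 1 by rewrite addr_gt0.
have pos n t : t \in `[n.+1%:R^-1 : R, n.+1%:R] -> 0 < t.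
  by rewrite in_itv/= => /andP[+ _]; apply: lt_le_trans; rewrite invr_gt0.
have L1 : \int[mu]_(t in `[n.+1%:R^-1, n.+1%:R]) gamma_integrand x t @[n --> \oo] --> Gamma_fun x.
  exact: cvg_Rintegral_invn (integrable_gamma x0).
have L2 : \int[mu]_(t in `[n.+1%:R^-1, n.+1%:R]) gamma_integrand (x + 1) t @[n --> \oo] --> Gamma_fun (x + 1).
  exact: cvg_Rintegral_invn (integrable_gamma x10).
apply/eqP; rewrite eq_sym -subr_eq0; apply/eqP.
apply: (@cvg_unique _ _ (x * (\int[mu]_(t in `[n.+1%:R^-1, n.+1%:R]) gamma_integrand x t)
  - \int[mu]_(t in `[n.+1%:R^-1, n.+1%:R]) gamma_integrand (x + 1) t @[n --> \oo])).
- exact: norm_hausdorff.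
- by apply: cvgB => //; apply: cvgM => //; exact: cvg_cst.
have ii n p : mu.-integrable `[n.+1%:R^-1, n.+1%:R] (EFin \o gamma_integrand p).
  by apply: integrable_continuous_itv => t /pos; exact: continuous_gamma_integrand.
have E n : x * (\int[mu]_(t in `[n.+1%:R^-1, n.+1%:R]) gamma_integrand x t)
  - \int[mu]_(t in `[n.+1%:R^-1, n.+1%:R]) gamma_integrand (x + 1) t =
  n.+1%:R `^ x * expR (- n.+1%:R) - n.+1%:R^-1 `^ x * expR (- n.+1%:R^-1).
  rewrite -RintegralZl//.
  have iz : mu.-integrable `[n.+1%:R^-1, n.+1%:R] (EFin \o (fun t => x * gamma_integrand x t)).
    apply: integrable_continuous_itv => t /pos t0; apply: cvgM; first exact: cvg_cst.
    exact: continuous_gamma_integrand.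
  rewrite -RintegralB//.
  rewrite (@Rintegral_FTC _ _ (fun t => t `^ x * expR (- t)))//.
  - by rewrite (@le_trans _ _ 1)// ?ler1n// invf_le1// ler1n.
  - move=> t /pos t0; have d := is_derive1_powR x t0.
    by apply: is_derive_eq; rewrite /GRing.scale/= /gamma_integrand addrK; ring.
  - move=> t /pos t0; apply: cvgB; last exact: continuous_gamma_integrand.
    by apply: cvgM; [exact: cvg_cst|exact: continuous_gamma_integrand].
rewrite /= (funext E).
rewrite -[X in _ --> X]subr0; apply: cvgB.
- have [C HC] := powR_expR_bounded (x + 1) ltr01.
  apply: (@squeeze_cvgr _ _ _ _ (fun=> 0) (fun n => C * n.+1%:R^-1)).
  + apply: nearW => n; rewrite mulr_ge0 ?powR_ge0 ?expR_ge0//=.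
    rewrite ler_pdivlMr// mulrAC -[X in _ * X * _]powRr1//.
    rewrite -powRD; last by apply/implyP; rewrite pnatr_eq0.
    by rewrite -[X in expR (- X)]mul1r HC// ler1n.
  + exact: cvg_cst.
  + rewrite -[X in _ --> X](mulr0 C); apply: cvgM; first exact: cvg_cst.
    exact: cvg_harmonic.
- apply: (@squeeze_cvgr _ _ _ _ (fun=> 0) (fun n => n.+1%:R^-1 `^ x)).
  + apply: nearW => n; rewrite mulr_ge0 ?powR_ge0 ?expR_ge0//=.
    by rewrite ler_piMr ?powR_ge0// expRN invf_le1 ?expR_gt0// -expR0 ler_expR.
  + exact: cvg_cst.
  + exact: cvg_powR_harmonic.
Qed.

Lemma Gamma_fun1 : Gamma_fun 1 = 1 :> R.
Proof.
have L : \int[mu]_(t in `[n.+1%:R^-1, n.+1%:R]) gamma_integrand 1 t @[n --> \oo] --> Gamma_fun (1 : R).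
  exact: cvg_Rintegral_invn (integrable_gamma ltr01).
apply: (@cvg_unique _ _ _ _ _ _ L); first exact: norm_hausdorff.
have E n : \int[mu]_(t in `[n.+1%:R^-1, n.+1%:R]) gamma_integrand 1 t =
  expR (- n.+1%:R^-1) - expR (- n.+1%:R).
  rewrite (@Rintegral_FTC _ _ (fun t => - expR (- t)))//.
  - by rewrite opprK addrC.
  - by rewrite (@le_trans _ _ 1)// ?ler1n// invf_le1// ler1n.
  - move=> t _; apply: is_derive_eq; rewrite /GRing.scale/= /gamma_integrand.
    by rewrite subrr powRr0; ring.
  - move=> t; rewrite in_itv/= => /andP[+ _] => /(lt_le_trans _) t0.
    by apply: continuous_gamma_integrand; apply: t0; rewrite invr_gt0.
rewrite /= (funext E) -[X in _ --> X]subr0; apply: cvgB.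
- rewrite -[X in _ --> X]expR0; apply: continuous_cvg; first exact: continuous_expR.
  by rewrite -[X in _ --> X]oppr0; apply: cvgN; exact: cvg_harmonic.
- exact: (cvg_comp _ _ cvg_natS (@cvgr_expR R)).
Qed.

(** Substitution of c t on segments. It evaluates both inner integrals when Tonelli's theorem is
    applied in [Gamma_fun_mul_Beta]. *)
Lemma Gamma_fun_scale (c x : R) : 0 < c -> 0 < x ->
  \int[mu]_(t in `]0, +oo[) (t `^ (x - 1) * expR (- (c * t))) = Gamma_fun x / c `^ x.
Proof.
move=> c0 x0.
have L1 := cvg_Rintegral_invn (integrable_powR_expR c0 x0).
apply: (@cvg_unique _ _ _ _ _ _ L1); first exact: norm_hausdorff.
have L2 : \int[mu]_(t in `[c * n.+1%:R^-1, c * n.+1%:R]) gamma_integrand x t @[n --> \oo] --> Gamma_fun x.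
  apply: cvg_Rintegral_pos (integrable_gamma x0) _ _ _.
  - by move=> n; rewrite mulr_gt0// invr_gt0.
  - by rewrite -[X in _ --> X](mulr0 c); apply: cvgM; [exact: cvg_cst|exact: cvg_harmonic].
  - apply/cvgryPge => M; have /cvgryPge/(_ (M / c)) := cvg_natS.
    by apply: filterS => n; rewrite ler_pdivrMr// mulrC.
have E n : \int[mu]_(t in `[n.+1%:R^-1, n.+1%:R]) (t `^ (x - 1) * expR (- (c * t))) =
   (\int[mu]_(t in `[c * n.+1%:R^-1, c * n.+1%:R]) gamma_integrand x t) / c `^ x.
  have nn : n.+1%:R^-1 <= n.+1%:R :> R.
    by rewrite (@le_trans _ _ 1)// ?ler1n// invf_le1// ler1n.
  have pos t : n.+1%:R^-1 <= t -> 0 < t.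
    by apply: lt_le_trans; rewrite invr_gt0.
  have dF (t : R) : is_derive t 1 (fun t => c * t) c.
    by apply: is_derive_eq; rewrite /GRing.scale/=; ring.
  rewrite (@Rintegral_subst _ (fun t => c * t) (fun=> c) (gamma_integrand x) _ _ nn dF)//.
  - rewrite -RintegralZr//.
    + apply: eq_Rintegral => t /set_mem/=; rewrite in_itv/= => /andP[/pos t0 _].
      rewrite /gamma_integrand powRM ?(ltW c0) ?(ltW t0)//.
      rewrite [c `^ (x - 1)]powRB ?powRr1 ?(ltW c0)//; last by apply/implyP; rewrite (gt_eqF c0).
      by field; rewrite !gt_eqF// powR_gt0.
    + apply: integrable_continuous_itv => t; rewrite in_itv/= => /andP[/pos t0 _].
      apply: cvgM; last exact: cvg_cst.
      apply: continuous_comp; last by apply: continuous_gamma_integrand; rewrite mulr_gt0.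
      by apply: cvgM; [exact: cvg_cst|exact: cvg_id].
  - by move=> t; exact: cvg_cst.
  - by move=> s t _ _; rewrite ltr_pM2l.
  - move=> t; rewrite in_itv/= => /andP[nt _]; apply: continuous_gamma_integrand.
    by apply: lt_le_trans nt; rewrite mulr_gt0// invr_gt0.
by rewrite /= (funext E); apply: cvgM => //; exact: cvg_cst.
Qed.

End gamma_function.

(** * Euler's Beta integral and its size near b = 0 *)

Section reflection.
Context {R : realType}.
Implicit Types (b x t u : R).
Notation mu := (@lebesgue_measure R).

Definition beta_integrand b u := u `^ (b - 1) / (1 + u).

Lemma continuous_beta_integrand b u : 0 < u -> {for u, continuous (beta_integrand b)}.
Proof.
move=> u0; apply: cvgM; first exact: continuous_powR.
apply: cvgV; first by rewrite gt_eqF// addr_gt0.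
by apply: cvgD; [exact: cvg_cst|exact: cvg_id].
Qed.

Lemma beta_integrand_ge0 b u : 0 < u -> 0 <= beta_integrand b u.
Proof. by move=> u0; rewrite divr_ge0 ?powR_ge0// addr_ge0 ?ltW. Qed.

Lemma beta_integrand_le0 b u : 0 < u -> beta_integrand b u <= u `^ (b - 1).
Proof.
move=> u0; rewrite ler_pdivrMr ?addr_gt0// ler_peMr ?powR_ge0//.
by rewrite lerDl ltW.
Qed.

Lemma beta_integrand_le1 b u : 0 < u -> beta_integrand b u <= u `^ (- (1 - b) - 1).
Proof.
move=> u0; rewrite ler_pdivrMr ?addr_gt0//.
rewrite (_ : - (1 - b) - 1 = b - 1 - 1); last by ring.
rewrite [u `^ (b - 1 - 1)]powRB ?powRr1 ?(ltW u0)//; last by apply/implyP; rewrite (gt_eqF u0).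
by rewrite mulrDr mulr1 divfK ?(gt_eqF u0)// lerDr divr_ge0 ?powR_ge0 ?(ltW u0).
Qed.

Lemma integrable_beta b : 0 < b -> b < 1 ->
  mu.-integrable `]0, +oo[ (EFin \o beta_integrand b).
Proof.
move=> b0 b1; apply: (@integrable_powR_bound _ _ b (1 - b) 1) => //.
- by rewrite subr_gt0.
- by apply: measurable_continuous_gt0 => t; exact: continuous_beta_integrand.
- move=> t t0 _; rewrite mul1r ger0_norm ?beta_integrand_ge0//.
  exact: beta_integrand_le0.
- move=> t t1; have t0 : 0 < t by exact: lt_le_trans t1.
  by rewrite mul1r ger0_norm ?beta_integrand_ge0// beta_integrand_le1.
Qed.

(* Euler's B(b, 1 - b). *)
Definition Beta b := \int[mu]_(u in `]0, +oo[) beta_integrand b u.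

Lemma invn_pos (n : nat) u : n.+1%:R^-1 <= u -> 0 < u.
Proof. by apply: lt_le_trans; rewrite invr_gt0. Qed.

Lemma invn_le1 (n : nat) : n.+1%:R^-1 <= 1 :> R.
Proof. by rewrite invf_le1// ler1n. Qed.

Lemma invn_len (n : nat) : n.+1%:R^-1 <= n.+1%:R :> R.
Proof. by rewrite (le_trans (invn_le1 n))// ler1n. Qed.

Lemma Rintegral_powR (a l u : R) : a != 0 -> 0 < l -> l <= u ->
  \int[mu]_(t in `[l, u]) (t `^ (a - 1)) = u `^ a / a - l `^ a / a.
Proof.
move=> a0 l0 lu.
have pos t : t \in `[l, u] -> 0 < t by rewrite in_itv/= => /andP[+ _]; exact: lt_le_trans.
rewrite (@Rintegral_FTC _ _ (fun t => t `^ a / a))//.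
- by move=> t /pos t0; exact: is_derive_powR_primitive.
- by move=> t /pos t0; exact: continuous_powR.
Qed.

(** Split at u = 1: the integrand is below u^(b-1) on one side and below u^(b-2) on the other. Only
    the pole 1/b matters later. *)
Lemma Beta_le b : 0 < b -> b < 1 -> Beta b <= b^-1 + (1 - b)^-1.
Proof.
move=> b0 b1; have b1' : 0 < 1 - b by rewrite subr_gt0.
have L := cvg_Rintegral_invn (integrable_beta b0 b1).
rewrite /Beta -(cvg_lim _ L)//; apply: limr_le; first by apply/cvg_ex; eexists; exact: L.
apply: nearW => n.
rewrite (Rintegral_itv_split (invn_le1 n)) ?ler1n//; last first.
  by move=> t; rewrite in_itv/= => /andP[/invn_pos t0 _]; exact: continuous_beta_integrand.
apply: lerD.
- apply: (@le_trans _ _ (\int[mu]_(t in `[n.+1%:R^-1, 1]) (t `^ (b - 1)))).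
    apply: le_Rintegral => //.
    + apply: integrable_continuous_itv => t; rewrite in_itv/= => /andP[/invn_pos t0 _].
      exact: continuous_beta_integrand.
    + apply: integrable_continuous_itv => t; rewrite in_itv/= => /andP[/invn_pos t0 _].
      exact: continuous_powR.
    + by move=> t /=; rewrite in_itv/= => /andP[/invn_pos t0 _]; exact: beta_integrand_le0.
  rewrite Rintegral_powR ?gt_eqF ?invr_gt0 ?invn_le1//.
  by rewrite powR1 mul1r gerBl divr_ge0 ?powR_ge0// ltW.
- have pos1 (t : R) : 1 <= t -> 0 < t by exact: lt_le_trans.
  apply: (@le_trans _ _ (\int[mu]_(t in `[1, n.+1%:R]) (t `^ (- (1 - b) - 1)))).
    apply: le_Rintegral => //.
    + apply: integrable_continuous_itv => t; rewrite in_itv/= => /andP[/pos1 t0 _].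
      exact: continuous_beta_integrand.
    + apply: integrable_continuous_itv => t; rewrite in_itv/= => /andP[/pos1 t0 _].
      exact: continuous_powR.
    + by move=> t /=; rewrite in_itv/= => /andP[/pos1 t0 _]; exact: beta_integrand_le1.
  rewrite Rintegral_powR ?ler1n// ?oppr_eq0 ?gt_eqF//.
  by rewrite powR1 invrN !mulrN mul1r opprK gerDr oppr_le0 divr_ge0 ?powR_ge0// ltW.
Qed.

(** On (0, 1] one has 1/(1+u) >= 1 - u, and the integral beyond 1 is nonnegative. The pole 1/b is
    that of [Beta_le], so together they give b Beta(b) -> 1 as b -> 0. *)
Lemma Beta_ge b : 0 < b -> b < 1 -> b^-1 - (1 + b)^-1 <= Beta b.
Proof.
move=> b0 b1; have b1' : 0 < 1 + b by rewrite addr_gt0.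
have L := cvg_Rintegral_invn (integrable_beta b0 b1).
have L' : (b^-1 - (1 + b)^-1) - (n.+1%:R^-1 `^ b) / b @[n --> \oo] --> b^-1 - (1 + b)^-1.
  rewrite -[X in _ --> X]subr0; apply: cvgB; first exact: cvg_cst.
  rewrite -[X in _ --> X](mul0r b^-1); apply: cvgM; last exact: cvg_cst.
  exact: cvg_powR_harmonic.
rewrite -(cvg_lim _ L')// /Beta -(cvg_lim _ L)//.
apply: ler_lim; [by apply/cvg_ex; eexists; exact: L'|by apply/cvg_ex; eexists; exact: L|].
apply: nearW => n.
rewrite (Rintegral_itv_split (invn_le1 n)) ?ler1n//; last first.
  by move=> t; rewrite in_itv/= => /andP[/invn_pos t0 _]; exact: continuous_beta_integrand.
rewrite -[leLHS]addr0; apply: lerD; last first.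
  apply: Rintegral_ge0 => t /=; rewrite in_itv/= => /andP[t1 _].
  by apply: beta_integrand_ge0; exact: lt_le_trans t1.
have i1 : mu.-integrable `[n.+1%:R^-1, 1] (EFin \o (fun t => t `^ (b - 1))).
  apply: integrable_continuous_itv => t; rewrite in_itv/= => /andP[/invn_pos t0 _].
  exact: continuous_powR.
have i2 : mu.-integrable `[n.+1%:R^-1, 1] (EFin \o (fun t => t `^ (1 + b - 1))).
  apply: integrable_continuous_itv => t; rewrite in_itv/= => /andP[/invn_pos t0 _].
  exact: continuous_powR.
apply: (@le_trans _ _ (\int[mu]_(t in `[n.+1%:R^-1, 1]) (t `^ (b - 1) - t `^ (1 + b - 1)))).
  rewrite RintegralB// !Rintegral_powR ?gt_eqF ?invr_gt0 ?invn_le1//.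
  rewrite !powR1 !mul1r.
  have : 0 <= n.+1%:R^-1 `^ (1 + b) / (1 + b) by rewrite divr_ge0 ?powR_ge0// ltW.
  lra.
apply: le_Rintegral => //.
- apply: integrable_continuous_itv => t; rewrite in_itv/= => /andP[/invn_pos t0 _].
  by apply: cvgB; exact: continuous_powR.
- apply: integrable_continuous_itv => t; rewrite in_itv/= => /andP[/invn_pos t0 _].
  exact: continuous_beta_integrand.
- move=> t /=; rewrite in_itv/= => /andP[/invn_pos t0 _].
  rewrite /beta_integrand ler_pdivlMr ?addr_gt0//.
  have -> : t `^ (1 + b - 1) = t `^ (b - 1) * t.
    rewrite (_ : 1 + b - 1 = b - 1 + 1); last by ring.
    by rewrite powRD ?powRr1 ?(ltW t0)//; apply/implyP; rewrite (gt_eqF t0).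
  have := powR_ge0 t (b - 1); nra.
Qed.

Lemma Re_le (z : R[i]) M : 0 <= M -> sqnorm z <= M ^+ 2 -> `|Re z| <= M.
Proof.
move=> M0 zM; rewrite -(ler_sqr (normr_ge0 _)) ?nnegrE// real_normK ?num_real//.
by rewrite (le_trans _ zM)// lerDl sqr_ge0.
Qed.

Lemma Im_le (z : R[i]) M : 0 <= M -> sqnorm z <= M ^+ 2 -> `|Im z| <= M.
Proof.
move=> M0 zM; rewrite -(ler_sqr (normr_ge0 _)) ?nnegrE// real_normK ?num_real//.
by rewrite (le_trans _ zM)// lerDr sqr_ge0.
Qed.

Lemma sqnormV (z : R[i]) : sqnorm z^-1 = (sqnorm z)^-1.
Proof.
have [->|z0] := eqVneq z 0; first by rewrite invr0 /sqnorm/= expr0n addr0 invr0.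
apply: (@mulfI _ (sqnorm z)); first by rewrite sqnorm_eq0.
by rewrite -sqnormM mulfV// mulfV ?sqnorm_eq0// /sqnorm/=; ring.
Qed.

Lemma sqnorm_cpow p r t : sqnorm (cpow p r t) = (r `^ p) ^+ 2.
Proof.
by rewrite /sqnorm /= !exprMn -mulrDr cos2Dsin2 mulr1.
Qed.

Lemma sqnorm_cexp (z : R[i]) : sqnorm (cexp z) = (expR (Re z)) ^+ 2.
Proof. by rewrite /sqnorm /= !exprMn -mulrDr cos2Dsin2 mulr1. Qed.

Lemma normr_Rintegral_le (f : R -> R) a c M : a <= c -> 0 <= M ->
  {in `[a, c], forall t, {for t, continuous f}} ->
  (forall t, a <= t <= c -> `|f t| <= M) ->
  `|\int[mu]_(t in `[a, c]) f t| <= M * (c - a).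
Proof.
move=> ac M0 cf fM; have fi := integrable_continuous_itv cf.
apply: le_trans (le_normr_Rintegral _ fi) _ => //.
apply: (@le_trans _ _ (\int[mu]_(t in `[a, c]) cst M t)).
  apply: le_Rintegral => //.
  - apply: integrable_continuous_itv => t tac; apply: continuous_comp; first exact: cf.
    exact: norm_continuous.
  - by apply: integrable_continuous_itv => t _; exact: cvg_cst.
rewrite Rintegral_cst//= lebesgue_measure_itv/= lte_fin.
by move: ac; rewrite le_eqVlt => /predU1P[->|->]; rewrite ?ltxx/= ?mulr0 ?subrr ?mulr0.
Qed.

End reflection.

(** * The quarter turn of the Beta integral *)

Section reflection_formula.
Context {R : realType}.
Implicit Types (b x t u : R).
Notation mu := (@lebesgue_measure R).

Lemma sqnorm_1Dcpow (r t : R) : 0 < r ->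
  sqnorm (1 + cpow 1 r t) = 1 + 2 * r * cos t + r ^+ 2.
Proof.
move=> r0; rewrite /sqnorm /= powRr1 ?(ltW r0)// !mul1r add0r.
transitivity (1 + 2 * r * cos t + r ^+ 2 * (cos t ^+ 2 + sin t ^+ 2)); first by ring.
by rewrite cos2Dsin2 mulr1.
Qed.

(* Rotate the ray of integration of [Beta b] by a quarter turn, then put v = u^2. *)
Lemma cos_Beta b : 0 < b -> b < 1 ->
  cos (b * (pi / 2)) * Beta b = Beta (b / 2) / 2.
Proof.
move=> b0 b1.
have ph0 : 0 <= pi / 2 :> R by rewrite divr_ge0 ?pi_ge0.
(* k = i e^{-i b pi/2}: on the imaginary axis k z^b = i r^b, and the imaginary part of i r^b / (1 +
   i r) is r^b / (1 + r^2); on the real axis Im k = cos (b pi/2) comes out as a factor. *)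
pose k : R[i] := sin (b * (pi / 2)) +i* cos (b * (pi / 2)).
pose f r t : R[i] := k * (cpow b r t * (1 + cpow 1 r t)^-1).
(* In the quarter plane cos t >= 0 keeps 1 + z away from 0. The bound by 1 makes the small arc
   vanish (as r^b), the bound by r^2 the large one (as r^(b-1)). *)
have N r t : 0 < r -> 0 <= t <= pi / 2 -> 1 <= sqnorm (1 + cpow 1 r t) /\ r ^+ 2 <= sqnorm (1 + cpow 1 r t).
  move=> r0 /andP[t0 t1]; rewrite sqnorm_1Dcpow//.
  have c0 : 0 <= 2 * r * cos t.
    by rewrite mulr_ge0 ?mulr_ge0 ?(ltW r0)// cos_ge0_pihalf// t1 andbT (le_trans _ t0)// oppr_le0.
  have : 0 <= r ^+ 2 by exact: sqr_ge0.
  by split; lra.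
have ne r t : 0 < r -> 0 <= t <= pi / 2 -> 1 + cpow 1 r t != 0.
  move=> r0 t0; rewrite -sqnorm_eq0 gt_eqF//.
  by have [+ _] := N _ _ r0 t0; exact: lt_le_trans.
have hf r t (r0 : 0 < r) (t0 : 0 <= t <= pi / 2) :=
  holM (hol_cst k r t) (holM (hol_cpow b t r0)
    (holV (ne _ _ r0 t0) (holD (hol_cst 1 r t) (hol_cpow 1 t r0)))).
have k1 : sqnorm k = 1 by rewrite /sqnorm/= addrC cos2Dsin2.
have fN r t : sqnorm (f r t) = (r `^ b) ^+ 2 / sqnorm (1 + cpow 1 r t).
  by rewrite !sqnormM k1 mul1r sqnorm_cpow sqnormV.
have f_le0 r t : 0 < r -> 0 <= t <= pi / 2 -> `|Re (f r t)| <= r `^ b.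
  move=> r0 t0; apply: Re_le; first exact: powR_ge0.
  have [N1 _] := N _ _ r0 t0.
  by rewrite fN ler_pdivrMr ?(lt_le_trans ltr01 N1)// ler_peMr// sqr_ge0.
have f_le1 r t : 0 < r -> 0 <= t <= pi / 2 -> `|Re (f r t)| <= r `^ (- (1 - b)).
  move=> r0 t0; apply: Re_le; first exact: powR_ge0.
  have [N1 N2] := N _ _ r0 t0.
  rewrite fN ler_pdivrMr ?(lt_le_trans ltr01 N1)// opprB.
  rewrite powRB ?powRr1 ?(ltW r0)//; last by apply/implyP; rewrite (gt_eqF r0).
  rewrite expr_div_n -mulrA ler_peMr ?sqr_ge0//.
  by rewrite ler_pdivlMl ?mulr1// exprn_gt0.
have cf r : 0 < r -> {in `[0, pi / 2], forall t, {for t, continuous (fun t => Re (f r t))}}.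
  move=> r0 t; rewrite in_itv/= => t0; have [_ _ _ _ c _ _ _] := hf r t r0 t0.
  exact: (cont2_phi c).
have E0 r : 0 < r -> Im (f r 0) / r = cos (b * (pi / 2)) * beta_integrand b r.
  move=> r0; rewrite /f !ImM !ReM /= !mulr0 cos0 sin0 powRr1 ?(ltW r0)//.
  rewrite !(mulr0, mulr1, mul1r, mul0r, addr0, add0r, subr0, oppr0, expr0n)/=.
  rewrite /beta_integrand powRB ?powRr1 ?(ltW r0)//; last by apply/implyP; rewrite (gt_eqF r0).
  by field; rewrite !gt_eqF// addr_gt0.
have E1 r : 0 < r -> Im (f r (pi / 2)) / r = r `^ (b - 1) / (1 + r ^+ 2).
  move=> r0; rewrite /f !ImM !ReM /= !mul1r cos_pihalf sin_pihalf.
  rewrite powRr1 ?(ltW r0)// !mulr1 mulr0 addr0 add0r.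
  rewrite powRB ?powRr1 ?(ltW r0)//; last by apply/implyP; rewrite (gt_eqF r0).
  have := cos2Dsin2 (b * (pi / 2)).
  move: (cos _) (sin _) => c s cs.
  have -> : r `^ b / r / (1 + r ^+ 2) = r `^ b / r / (1 + r ^+ 2) * (c ^+ 2 + s ^+ 2).
    by rewrite cs mulr1.
  field; rewrite (gt_eqF r0)/= !gt_eqF// ?expr1n ?addr_gt0 ?exprn_gt0//.
have g1S n : \int[mu]_(r in `[n.+1%:R^-1, n.+1%:R]) (r `^ (b - 1) / (1 + r ^+ 2)) =
    (\int[mu]_(r in `[n.+1%:R^-1 ^+ 2, n.+1%:R ^+ 2]) beta_integrand (b / 2) r) / 2.
  have dF (t : R) : is_derive t 1 (fun t => t ^+ 2) (2 * t).
    by apply: is_derive_eq; rewrite /GRing.scale/=; ring.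
  rewrite (@Rintegral_subst _ (fun t => t ^+ 2) (fun t => 2 * t) (beta_integrand (b / 2)) _ _ (invn_len n) dF).
  - rewrite -RintegralZr//.
    + apply: eq_Rintegral => t /set_mem/=; rewrite in_itv/= => /andP[/invn_pos t0 _].
      rewrite /beta_integrand -powR_mulrn ?(ltW t0)// -powRrM.
      rewrite (_ : 2%:R * (b / 2 - 1) = (b - 1) - 1); last by field.
      rewrite [t `^ (b - 1 - 1)]powRB ?powRr1 ?(ltW t0)//; last by apply/implyP; rewrite (gt_eqF t0).
      by field; rewrite !gt_eqF// addr_gt0// powR_gt0.
    + apply: integrable_continuous_itv => t; rewrite in_itv/= => /andP[/invn_pos t0 _].
      apply: cvgM; last by apply: cvgM; [exact: cvg_cst|exact: cvg_id].
      apply: (@continuous_comp _ _ _ (fun t => t ^+ 2) (beta_integrand (b / 2)) t).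
        exact: exprn_continuous.
      by apply: continuous_beta_integrand; rewrite exprn_gt0.
  - by move=> t; apply: cvgM; [exact: cvg_cst|exact: cvg_id].
  - move=> s t; rewrite !in_itv/= => /andP[/invn_pos s0 _] /andP[/invn_pos t0 _] st.
    by rewrite ltr_pXn2r// nnegrE ltW.
  - move=> t; rewrite in_itv/= => /andP[nt _]; apply: continuous_beta_integrand.
    by apply: lt_le_trans nt; rewrite exprn_gt0// invr_gt0.
have L1 : \int[mu]_(r in `[n.+1%:R^-1, n.+1%:R]) (r `^ (b - 1) / (1 + r ^+ 2)) @[n --> \oo] --> Beta (b / 2) / 2.
  rewrite (funext g1S); apply: cvgM; last exact: cvg_cst.
  apply: cvg_Rintegral_pos.
  - by apply: integrable_beta; lra.
  - by move=> n; rewrite exprn_gt0// invr_gt0.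
  - by rewrite -[X in _ --> X](mulr0 0); apply: cvgM; exact: cvg_harmonic.
  - apply/cvgryPge => M; have /cvgryPge/(_ M) := @cvg_natS R.
    apply: filterS => n Mn; rewrite (le_trans Mn)// expr2 ler_peMr// ler1n//.
have L0 : \int[mu]_(r in `[n.+1%:R^-1, n.+1%:R]) beta_integrand b r @[n --> \oo] --> Beta b.
  exact: cvg_Rintegral_invn (integrable_beta b0 b1).
have i0 n : mu.-integrable `[n.+1%:R^-1, n.+1%:R] (EFin \o beta_integrand b).
  apply: integrable_continuous_itv => t; rewrite in_itv/= => /andP[/invn_pos t0 _].
  exact: continuous_beta_integrand.
have i0k n : mu.-integrable `[n.+1%:R^-1, n.+1%:R] (EFin \o (fun r => cos (b * (pi / 2)) * beta_integrand b r)).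
  apply: integrable_continuous_itv => t; rewrite in_itv/= => /andP[/invn_pos t0 _].
  by apply: cvgM; [exact: cvg_cst|exact: continuous_beta_integrand].
have i1 n : mu.-integrable `[n.+1%:R^-1, n.+1%:R] (EFin \o (fun r => r `^ (b - 1) / (1 + r ^+ 2))).
  apply: integrable_continuous_itv => t; rewrite in_itv/= => /andP[/invn_pos t0 _].
  apply: cvgM; first exact: continuous_powR.
  apply: cvgV; first by rewrite gt_eqF// addr_gt0// exprn_gt0.
  by apply: cvgD; [exact: cvg_cst|exact: exprn_continuous].
pose arc r := \int[mu]_(t in `[0, pi / 2]) Re (f r t).
have D n : \int[mu]_(r in `[n.+1%:R^-1, n.+1%:R]) (r `^ (b - 1) / (1 + r ^+ 2)) -
    cos (b * (pi / 2)) * (\int[mu]_(r in `[n.+1%:R^-1, n.+1%:R]) beta_integrand b r) =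
    arc n.+1%:R - arc n.+1%:R^-1.
  have n0 : 0 < n.+1%:R^-1 :> R by rewrite invr_gt0.
  rewrite /arc (rectangle_theorem ph0 n0 (invn_len n) hf).
  rewrite -RintegralZl// -RintegralB//.
  apply: eq_Rintegral => r /set_mem/=; rewrite in_itv/= => /andP[/invn_pos r0 _].
  by rewrite -E1// -E0// -mulrBl.
have arc0 r : 0 < r -> `|arc r| <= r `^ b * (pi / 2).
  move=> r0; rewrite -[X in _ * X]subr0; apply: normr_Rintegral_le => //.
  + exact: powR_ge0.
  + exact: cf.
  + by move=> t; exact: f_le0.
have arc1 r : 0 < r -> `|arc r| <= r `^ (- (1 - b)) * (pi / 2).
  move=> r0; rewrite -[X in _ * X]subr0; apply: normr_Rintegral_le => //.
  + exact: powR_ge0.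
  + exact: cf.
  + by move=> t; exact: f_le1.
have D0 : arc n.+1%:R - arc n.+1%:R^-1 @[n --> \oo] --> (0 : R).
  rewrite -[X in _ --> X]subr0; apply: cvgB.
  - apply/norm_cvg0P; apply: (@squeeze_cvgr _ _ _ _ (fun=> 0) (fun n => n.+1%:R^-1 `^ (1 - b) * (pi / 2))).
    + by apply: nearW => n; rewrite normr_ge0/= powRV ?arc1.
    + exact: cvg_cst.
    + rewrite -[X in _ --> X](mul0r (pi / 2)); apply: cvgM; last exact: cvg_cst.
      by apply: cvg_powR_harmonic; rewrite subr_gt0.
  - apply/norm_cvg0P; apply: (@squeeze_cvgr _ _ _ _ (fun=> 0) (fun n => n.+1%:R^-1 `^ b * (pi / 2))).
    + by apply: nearW => n; rewrite normr_ge0/= arc0 ?invr_gt0.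
    + exact: cvg_cst.
    + rewrite -[X in _ --> X](mul0r (pi / 2)); apply: cvgM; last exact: cvg_cst.
      exact: cvg_powR_harmonic.
apply/eqP; rewrite eq_sym -subr_eq0; apply/eqP.
rewrite -(funext D) in D0.
apply: cvg_unique D0; first exact: norm_hausdorff.
by apply: cvgB => //; apply: cvgM => //; exact: cvg_cst.
Qed.
End reflection_formula.

(** * The reflection formula *)

Section gamma_reflection.
Context {R : realType}.
Implicit Types (b x t u : R).
Notation mu := (@lebesgue_measure R).

(** The factor cos (b pi/2) produced by the quarter turn is the one in sin (b pi) = 2 sin (b pi/2)
    cos (b pi/2). *)
Lemma Beta_sin_halve b : 0 < b -> b < 1 ->
  Beta b * sin (b * pi) = Beta (b / 2) * sin (b / 2 * pi).
Proof.
move=> b0 b1; have H := cos_Beta b0 b1.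
have -> : b * pi = (b * (pi / 2)) *+ 2 by rewrite mulr2n; field.
have -> : b / 2 * pi = b * (pi / 2) by field.
have -> : Beta (b / 2) = 2 * (cos (b * (pi / 2)) * Beta b) by rewrite H; field.
by rewrite sin_mulr2n mulr2n; ring.
Qed.

(** The product is constant along x n = b / 2^n; written as (x Beta(x)) (sin (x pi) / x), it tends
    to 1 times pi. *)
Lemma Beta_sin b : 0 < b -> b < 1 -> Beta b * sin (b * pi) = pi.
Proof.
move=> b0 b1.
pose x (n : nat) := b / 2 ^+ n.
have x0 n : 0 < x n by rewrite divr_gt0// exprn_gt0.
have xS n : x n.+1 = x n / 2 by rewrite /x exprSr invfM mulrA.
have x1 n : x n < 1.
  elim: n => [|n IH]; first by rewrite /x expr0 divr1.
  by rewrite xS; have := x0 n; lra.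
have xE n : Beta b * sin (b * pi) = Beta (x n) * sin (x n * pi).
  elim: n => [|n ->]; first by rewrite /x expr0 divr1.
  by rewrite xS; apply: Beta_sin_halve.
have cx : x n @[n --> \oo] --> (0 : R).
  rewrite -[X in _ --> X](mulr0 b); apply: cvgM; first exact: cvg_cst.
  have -> : (fun n => (2 ^+ n)^-1) = (fun n => (2^-1 : R) ^+ n).
    by apply/funext => n; rewrite exprVn.
  by apply: cvg_expr; rewrite ger0_norm ?invr_ge0// invf_lt1// ltr1n.
have B1 : x n * Beta (x n) @[n --> \oo] --> (1 : R).
  apply: (@squeeze_cvgr _ _ _ _ (fun n => 1 - x n / (1 + x n)) (fun n => 1 + x n / (1 - x n))).
  - apply: nearW => n; have y0 := x0 n; have y1 := x1 n.
    have /(ler_wpM2l (ltW y0)) l1 := Beta_ge y0 y1.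
    have /(ler_wpM2l (ltW y0)) l2 := Beta_le y0 y1.
    apply/andP; split.
      apply: le_trans l1; rewrite mulrBr mulfV ?gt_eqF//.
    by apply: le_trans l2 _; rewrite mulrDr mulfV ?gt_eqF//.
  - rewrite -[X in _ --> X]subr0; apply: cvgB; first exact: cvg_cst.
    rewrite -[X in _ --> X](mul0r (1 + 0)^-1); apply: cvgM => //.
    apply: cvgV; first by rewrite addr0 oner_eq0.
    by apply: cvgD => //; exact: cvg_cst.
  - rewrite -[X in _ --> X]addr0; apply: cvgD; first exact: cvg_cst.
    rewrite -[X in _ --> X](mul0r (1 - 0)^-1); apply: cvgM => //.
    apply: cvgV; first by rewrite subr0 oner_eq0.
    by apply: cvgB => //; exact: cvg_cst.
(* The difference quotient at 0 of t |-> sin (t pi), taken along a sequence of nonzero points. *)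
have S1 : (x n)^-1 * sin (x n * pi) @[n --> \oo] --> (pi : R).
  have d : is_derive (0 : R) (1 : R) (fun t => sin (t * pi)) pi.
    by apply: is_derive_eq; rewrite /GRing.scale/= mul0r cos0; ring.
  have [dd dv] := d.
  have := dd; rewrite /derivable /= => /cvg_ex[l ll].
  have lE : l = pi by rewrite -dv; exact/esym/cvg_lim.
  rewrite lE in ll.
  have cx' : x @ \oo --> (0 : R)^'.
    move=> P [e /= e0 Pe].
    suff : \forall n \near \oo, P (x n) by [].
    move/cvgrPdist_lt : cx => /(_ _ e0); apply: filterS => n xn.
    by apply: Pe => //=; rewrite gt_eqF.
  have := cvg_comp _ _ cx' ll.
  apply: cvg_trans; apply: near_eq_cvg; apply: nearW => n /=.
  by rewrite /GRing.scale/= mulr1 addr0 mul0r sin0 subr0.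
apply: (@cvg_unique _ _ (Beta b * sin (b * pi) @[_ --> \oo])).
- exact: norm_hausdorff.
- exact: cvg_cst.
- rewrite /= -[X in _ --> X]mul1r.
  rewrite (_ : (fun=> _) = (fun n => (x n * Beta (x n)) * ((x n)^-1 * sin (x n * pi)))).
    exact: cvgM.
  by apply/funext => n; rewrite (xE n); field; rewrite gt_eqF.
Qed.

Local Notation D := (`]0%R, +oo[%classic : set (measurableTypeR R)).

(** Tonelli's theorem is applied on the whole plane, so half-line integrals are rewritten there with
    indicators. *)
Lemma integral_indic_pos (g : R -> R) : mu.-integrable D (EFin \o g) ->
  (\int[mu]_x (\1_D x * g x)%:E = (\int[mu]_(x in D) g x)%:E)%E.
Proof.
move=> gi; rewrite /Rintegral fineK; last exact: (integrable_fin_num (measurable_itvR _) gi).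
rewrite [RHS]integral_mkcond; apply: eq_integral => x _.
by rewrite patchE indicE; case: (x \in D); rewrite ?mul1r ?mul0r.
Qed.

(** Both sides are iterated integrals of u^(b-1) e^(-(1+u) r): integrating in u first gives e^-r
    r^-b Gamma(b), whose integral is the product; integrating in r first gives u^(b-1) / (1+u). *)
Lemma Gamma_fun_mul_Beta b : 0 < b -> b < 1 ->
  Gamma_fun (1 - b) * Gamma_fun b = Beta b.
Proof.
move=> b0 b1; have b1' : 0 < 1 - b by rewrite subr_gt0.
have inD x : (x \in D) = (0 < x) by rewrite mem_setE in_itv/= andbT.
pose f (p : measurableTypeR R * measurableTypeR R) : \bar R :=
  (\1_D p.1 * \1_D p.2 * (p.2 `^ (b - 1) * expR (- ((1 + p.2) * p.1))))%:E.
have mf : measurable_fun setT f.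
  have m1 : measurable_fun setT (fun p : measurableTypeR R * measurableTypeR R => p.1 : R).
    exact (@measurable_fst _ _ (measurableTypeR R) (measurableTypeR R)).
  have m2 : measurable_fun setT (fun p : measurableTypeR R * measurableTypeR R => p.2 : R).
    exact (@measurable_snd _ _ (measurableTypeR R) (measurableTypeR R)).
  have m3 : measurable_fun setT (\1_D : R -> R).
    exact (@measurable_indic _ (measurableTypeR R) R setT D (measurable_itvR _)).
  have m4 : measurable_fun setT (fun p : measurableTypeR R * measurableTypeR R => \1_D p.1 : R) by exact: (measurableT_comp m3 m1).
  have m5 : measurable_fun setT (fun p : measurableTypeR R * measurableTypeR R => \1_D p.2 : R) by exact: (measurableT_comp m3 m2).
  have m6 : measurable_fun setT (fun p : measurableTypeR R * measurableTypeR R => p.2 `^ (b - 1)).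
    exact (measurableT_comp (measurable_powR (b - 1)) m2).
  have m7 : measurable_fun setT (fun p : measurableTypeR R * measurableTypeR R => (1 + p.2) * p.1 : R).
    by apply: (measurable_funM _ m1); apply: (measurable_funD _ m2); exact: measurable_cst.
  have m8 : measurable_fun setT (fun p : measurableTypeR R * measurableTypeR R => expR (- ((1 + p.2) * p.1))).
    by apply: (measurableT_comp (@measurable_expR R)); exact: (measurableT_comp (@oppr_measurable R setT) m7).
  apply/measurable_EFinP.
  exact: (measurable_funM (measurable_funM m4 m5) (measurable_funM m6 m8)).
have f0 p : (0 <= f p)%E.
  by rewrite lee_fin !mulr_ge0 ?powR_ge0 ?expR_ge0.
have := @fubini_tonelli _ _ _ _ _ mu mu f mf f0.
have -> : (\int[mu]_x \int[mu]_y f (x, y) = (Gamma_fun (1 - b) * Gamma_fun b)%:E)%E.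
  have i1 := integrable_gamma b1'.
  rewrite -RintegralZr// -integral_indic_pos; last first.
    have := integrableZr (measurable_itvR _) (Gamma_fun b) i1.
    by apply: eq_integrable => // x _ /=; rewrite EFinM.
  apply: eq_integral => r _.
  have [r0|r0] := boolP (r \in D); last first.
    rewrite indicE (negbTE r0) mul0r integral0_eq// => y _.
    by rewrite /f /= indicE (negbTE r0) !mul0r.
  rewrite inD in r0.
  have i2 := integrable_powR_expR r0 b0.
  transitivity (\int[mu]_u (\1_D u * (expR (- r) * (u `^ (b - 1) * expR (- (r * u)))))%:E)%E.
    apply: eq_integral => u _; rewrite /f /= [\1_D r]indicE inD r0 mul1r.
    congr (_%:E); congr (_ * _); rewrite mulrCA -expRD; congr (_ * expR _); ring.
  rewrite integral_indic_pos; last first.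
    have := integrableZl (measurable_itvR _) (expR (- r)) i2.
    by apply: eq_integrable => // x _ /=; rewrite EFinM.
  rewrite RintegralZl// Gamma_fun_scale// indicE inD r0 mul1r.
  rewrite (_ : 1 - b - 1 = - b); last by ring.
  by rewrite powRN; congr (_%:E); ring.
have -> : (\int[mu]_y \int[mu]_x f (x, y) = (Beta b)%:E)%E.
  rewrite -integral_indic_pos; last exact: integrable_beta.
  apply: eq_integral => u _.
  have [u0|u0] := boolP (u \in D); last first.
    rewrite indicE (negbTE u0) mul0r integral0_eq// => y _.
    by rewrite /f /= [\1_D u]indicE (negbTE u0) mulr0 !mul0r.
  rewrite inD in u0.
  have u10 : 0 < 1 + u by rewrite addr_gt0.
  have i2 := integrable_powR_expR u10 ltr01.
  transitivity (\int[mu]_r (\1_D r * (u `^ (b - 1) * (r `^ (1 - 1) * expR (- ((1 + u) * r)))))%:E)%E.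
    apply: eq_integral => r _; rewrite /f /= [\1_D u]indicE inD u0 mulr1.
    by rewrite subrr powRr0 mul1r.
  rewrite integral_indic_pos; last first.
    have := integrableZl (measurable_itvR _) (u `^ (b - 1)) i2.
    by apply: eq_integrable => // x _ /=; rewrite EFinM.
  rewrite RintegralZl// Gamma_fun_scale// indicE inD u0 mul1r.
  by rewrite Gamma_fun1 powRr1 ?(ltW u10)// mul1r.
by move=> [].
Qed.

Lemma Gamma_fun_reflection b : 0 < b -> b < 1 ->
  Gamma_fun b * Gamma_fun (1 - b) * sin (b * pi) = pi.
Proof.
by move=> b0 b1; rewrite [Gamma_fun b * _]mulrC Gamma_fun_mul_Beta// Beta_sin.
Qed.

End gamma_reflection.

(** * The Hankel contour *)

Section hankel.
Context {R : realType}.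
Implicit Types (F G : R -> R -> R[i]) (a b p q r t : R).
Notation mu := (@lebesgue_measure R).

Lemma cpowD p q r t : 0 < r -> cpow p r t * cpow q r t = cpow (p + q) r t.
Proof.
move=> r0; apply/eqP; rewrite eq_complex /= mulrDl cosD sinD powRD.
  by apply/andP; split; apply/eqP; ring.
by apply/implyP; rewrite (gt_eqF r0).
Qed.

Lemma cpow0 r t : cpow 0 r t = 1.
Proof. by apply/eqP; rewrite eq_complex /= powRr0 mul0r cos0 sin0 mulr0 mulr1 !eqxx. Qed.

Lemma cvg_Rintegral_dominated (D : set (measurableTypeR R)) (f_ : nat -> R -> R) (f g : R -> R) :
  measurable D -> (forall n, mu.-integrable D (EFin \o f_ n)) ->
  mu.-integrable D (EFin \o f) -> mu.-integrable D (EFin \o g) ->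
  (forall x, D x -> f_ n x @[n --> \oo] --> f x) ->
  (forall n x, D x -> `|f_ n x| <= g x) ->
  \int[mu]_(x in D) f_ n x @[n --> \oo] --> \int[mu]_(x in D) f x.
Proof.
move=> mD fi_ fi gi cf fg; apply: fine_cvg; rewrite fineK; last first.
  exact: integrable_fin_num fi.
apply: (@dominated_cvg _ _ _ mu _ _ (fun n => EFin \o f_ n) (EFin \o f) (EFin \o g)) => //.
- by move=> n; exact: (measurable_int mu (fi_ n)).
- by move=> x Dx; apply: cvg_EFin; [exact: nearW|exact: cf].
Qed.

(* [hankel F a] is (1/2 pi i) \int e^z F(z) dz along the contour made of the circle
   of radius [a] and of the two sides of the negative axis beyond it; for F real on
   the positive axis the lower half is the conjugate of the upper one, which is the
   only one computed. *)
Definition hankel_kernel F r t := cexp (cpow 1 r t) * (cpow 1 r t * F r t).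

Definition hankel_arc F a := \int[mu]_(t in `[0, pi]) Re (hankel_kernel F a t).

Definition hankel_ray F a := \int[mu]_(r in `]a, +oo[) (expR (- r) * Im (F r pi)).

Definition hankel F a := (hankel_arc F a - hankel_ray F a) / pi.

Lemma Im_hankel_kernel_pi F r : 0 < r ->
  Im (hankel_kernel F r pi) / r = - (expR (- r) * Im (F r pi)).
Proof.
move=> r0; rewrite /hankel_kernel !ImM !ReM /= !mul1r sinpi cospi powRr1 ?(ltW r0)//.
rewrite !(mulr0, sin0, cos0, mulrN1, mul0r, addr0, add0r, subr0, mulr1).
by field; rewrite gt_eqF.
Qed.

Lemma Im_hankel_kernel_0 F r : Im (F r 0) = 0 -> Im (hankel_kernel F r 0) = 0.
Proof.
move=> F0; rewrite /hankel_kernel !ImM !ReM /= F0 !mulr0 sin0 !mulr0 sin0.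
by rewrite !(mulr0, mul0r, addr0).
Qed.

Lemma hol_hankel_kernel F G r t : 0 < r -> hol F G r t ->
  hol (hankel_kernel F)
   (fun s t => 1%:C * cpow 1 s t * cexp (cpow 1 s t) * (cpow 1 s t * F s t) +
     cexp (cpow 1 s t) * (1%:C * cpow 1 s t * F s t + cpow 1 s t * G s t)) r t.
Proof.
move=> r0 hF.
exact: (holM (hol_cexp (hol_cpow 1 t r0)) (holM (hol_cpow 1 t r0) hF)).
Qed.

(** [rectangle_theorem] integrates against dz/z, hence the factor z in [hankel_kernel]. The kernel
    is real on the positive axis, so that side contributes nothing, and the side on the negative
    axis is exactly what the ray loses between a and b. *)
Lemma hankel_shift F G a b : 0 < a -> a <= b ->
  (forall r t, 0 < r -> 0 <= t <= pi -> hol F G r t) ->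
  (forall r, 0 < r -> Im (F r 0) = 0) ->
  mu.-integrable `]a, +oo[ (EFin \o (fun r => expR (- r) * Im (F r pi))) ->
  hankel F a = hankel F b.
Proof.
move=> a0 ab hF F0 iF.
have hk r t (r0 : 0 < r) (t0 : 0 <= t <= pi) := hol_hankel_kernel r0 (hF r t r0 t0).
have := rectangle_theorem (pi_ge0 R) a0 ab hk.
have -> : \int[mu]_(r in `[a, b]) ((Im (hankel_kernel F r pi) - Im (hankel_kernel F r 0)) / r)
   = - (\int[mu]_(r in `[a, b]) (expR (- r) * Im (F r pi))).
  rewrite -mulN1r -RintegralZl//; last first.
    apply: integrable_continuous_itv => r; rewrite in_itv/= => /andP[ar _].
    have r0 := lt_le_trans a0 ar.
    have rp : 0 <= (pi : R) <= pi by rewrite pi_ge0 lexx.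
    have [_ _ _ _ _ c _ _] := hF r pi r0 rp.
    apply: cvgM; last exact: (cont2_r c).
    by apply: continuous_comp; [exact: opp_continuous|exact: continuous_expR].
  apply: eq_Rintegral => r /set_mem/=; rewrite in_itv/= => /andP[ar _].
  have r0 := lt_le_trans a0 ar.
  by rewrite (Im_hankel_kernel_0 (F0 r r0)) subr0 (Im_hankel_kernel_pi F r0) mulN1r.
have iab : mu.-integrable `]a, b] (EFin \o (fun r => expR (- r) * Im (F r pi))).
  apply: (integrableS _ _ _ iF); [exact: measurable_itvR|exact: measurable_itvR|].
  by apply: subset_itvl; rewrite bnd_simp.
have ray : hankel_ray F a - \int[mu]_(r in `[a, b]) (expR (- r) * Im (F r pi)) = hankel_ray F b.
  by rewrite /hankel_ray -(Rintegral_itvB iF (x := b)) ?bnd_simp// (Rintegral_itv_obnd_cbnd iab).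
rewrite -[\int[mu]_(t in `[0, pi]) Re (hankel_kernel F b t)]/(hankel_arc F b).
rewrite -[\int[mu]_(t in `[0, pi]) Re (hankel_kernel F a t)]/(hankel_arc F a).
rewrite /hankel -ray => /eqP; rewrite subr_eq => /eqP ->; congr (_ / _).
by rewrite opprB [- _ + _]addrC addrA subrK.
Qed.

(** By [hankel_shift] the value is the same at every radius, so it can be computed in the limit of
    radius 0, where the ray becomes the whole half-line and the arc contributes its limit L. *)
Lemma hankel_limit F G a (L : R) : 0 < a ->
  (forall r t, 0 < r -> 0 <= t <= pi -> hol F G r t) ->
  (forall r, 0 < r -> Im (F r 0) = 0) ->
  mu.-integrable `]0, +oo[ (EFin \o (fun r => expR (- r) * Im (F r pi))) ->
  hankel_arc F n.+1%:R^-1 @[n --> \oo] --> L ->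
  hankel F a = (L - \int[mu]_(r in `]0, +oo[) (expR (- r) * Im (F r pi))) / pi.
Proof.
move=> a0 hF F0 iF aL.
have iFb b : 0 < b -> mu.-integrable `]b, +oo[ (EFin \o (fun r => expR (- r) * Im (F r pi))).
  move=> b0; apply: (integrableS _ _ _ iF); [exact: measurable_itvR|exact: measurable_itvR|].
  by apply: subset_itvr; rewrite bnd_simp ltW.
have E n : hankel F n.+1%:R^-1 = hankel F a.
  have n0 : 0 < n.+1%:R^-1 :> R by rewrite invr_gt0.
  have [na|/ltW an] := leP n.+1%:R^-1 a.
    by rewrite (hankel_shift n0 na hF F0)//; exact: iFb.
  by rewrite -(hankel_shift a0 an hF F0)//; exact: iFb.
apply: (@cvg_unique _ _ (hankel F n.+1%:R^-1 @[n --> \oo])).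
- exact: norm_hausdorff.
- by rewrite /= (funext E); exact: cvg_cst.
- apply: cvgM; last exact: cvg_cst.
  apply: cvgB => //; apply: cvg_Rintegral_exhaust => //.
  + by move=> n; apply: subset_itvr; rewrite bnd_simp invr_ge0.
  + move=> x /=; rewrite in_itv/= andbT => x0.
    have /cvgrPdist_lt/(_ _ x0) := @cvg_harmonic R.
    apply: filterS => n /=; rewrite sub0r normrN ger0_norm ?invr_ge0// => nx.
    by rewrite in_itv/= andbT.
Qed.

Lemma Re_hankel_kernel_le F r t M : 0 < r -> 0 <= M -> sqnorm (F r t) <= M ^+ 2 ->
  `|Re (hankel_kernel F r t)| <= expR r * r * M.
Proof.
move=> r0 M0 FM; apply: Re_le; first by rewrite !mulr_ge0 ?expR_ge0 ?(ltW r0).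
rewrite !sqnormM sqnorm_cexp sqnorm_cpow powRr1 ?(ltW r0)// mulrA -exprMn.
rewrite [leRHS]exprMn ler_pM ?sqr_ge0 ?sqnorm_ge0//.
rewrite ler_sqr ?nnegrE ?mulr_ge0 ?expR_ge0 ?(ltW r0)//.
rewrite ler_wpM2r ?(ltW r0)// ler_expR /= powRr1 ?(ltW r0)//.
by rewrite ler_piMr ?(ltW r0)// cos_le1.
Qed.

Lemma continuous_Re_hankel_kernel F G a :
  0 < a -> (forall t, 0 <= t <= pi -> hol F G a t) ->
  {in `[0, pi], forall t, {for t, continuous (fun t => Re (hankel_kernel F a t))}}.
Proof.
move=> a0 hF t; rewrite in_itv/= => t0.
have [_ _ _ _ c _ _ _] := hol_hankel_kernel a0 (hF t t0).
exact: (cont2_phi c).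
Qed.

Lemma hankel_arc_le F G a M : 0 < a -> 0 <= M ->
  (forall t, 0 <= t <= pi -> hol F G a t) ->
  (forall t, 0 <= t <= pi -> sqnorm (F a t) <= M ^+ 2) ->
  `|hankel_arc F a| <= expR a * a * M * pi.
Proof.
move=> a0 M0 hF FM; rewrite -[X in _ * X]subr0.
apply: normr_Rintegral_le; first exact: pi_ge0.
- by rewrite !mulr_ge0 ?expR_ge0 ?(ltW a0).
- exact: continuous_Re_hankel_kernel hF.
- by move=> t t0; apply: Re_hankel_kernel_le => //; exact: FM.
Qed.

End hankel.

(** * Integrals along the ray, and Hankel's formula for b < 1 *)

Section hankel_gamma.
Context {R : realType}.
Implicit Types (F G : R -> R -> R[i]) (a b p q r t : R).
Notation mu := (@lebesgue_measure R).

(** The ray stays away from 0, so any real exponent is allowed: with q = |p| + 1 one has p + 1 - q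
    <= 0, hence r^p <= a^(p+1-q) r^(q-1) for r > a, a multiple of the power in the integral of
    Gamma(q). *)
Lemma integrable_expR_powR_y p a : 0 < a ->
  mu.-integrable `]a, +oo[ (EFin \o (fun r => expR (- r) * r `^ p)).
Proof.
move=> a0; pose q := `|p| + 1.
have q0 : 0 < q by rewrite ltr_wpDl.
have pq : p + 1 <= q by rewrite lerD2r ler_norm.
have := integrableZl (measurable_itvR _) (a `^ (p + 1 - q)) (integrable_gamma q0).
move=> /(integrableS (measurable_itvR _) (measurable_itvR `]a, +oo[)).
have S : `]a, +oo[ `<=` `]0, +oo[.
  by apply: subset_itvr; rewrite bnd_simp ltW.
move=> /(_ S); apply: le_integrable; first exact: measurable_itvR.
  apply/measurable_EFinP; apply: (measurable_funS (measurable_itvR _) S).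
  apply: measurable_continuous_gt0 => r r0; apply: cvgM; last exact: continuous_powR.
  by apply: continuous_comp; [exact: opp_continuous|exact: continuous_expR].
move=> r /=; rewrite in_itv/= andbT => ar; have r0 := lt_trans a0 ar.
rewrite lee_fin /gamma_integrand !ger0_norm ?mulr_ge0 ?powR_ge0 ?expR_ge0//.
rewrite [leRHS]mulrA [leRHS]mulrC ler_wpM2l ?expR_ge0//.
have -> : p = (p + 1 - q) + (q - 1) by ring.
rewrite [leLHS]powRD; last by apply/implyP; rewrite (gt_eqF r0).
rewrite (_ : p + 1 - q + (q - 1) + 1 - q = - (q - (p + 1))); last by ring.
rewrite (_ : p + 1 - q = - (q - (p + 1))); last by ring.
rewrite ler_wpM2r ?powR_ge0// !powRN lef_pV2 ?posrE ?powR_gt0//.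
by apply: ge0_ler_powR; rewrite ?nnegrE ?subr_ge0 ?(ltW a0) ?(ltW r0) ?(ltW ar).
Qed.

(** The integrand is the derivative of - e^-r r^-p, and p >= 0 makes it nonnegative, as the
    half-line form of the fundamental theorem wants. It serves for the boundary term of the ray in
    [hankel_cpowS], and with p = 0 for the integral of e^-r in [hankel_le]. *)
Lemma Rintegral_expR_powR_y p a : 0 < a -> 0 <= p ->
  \int[mu]_(r in `]a, +oo[) (expR (- r) * (r `^ (- p) + p * r `^ (- p - 1))) =
  expR (- a) * a `^ (- p).
Proof.
move=> a0 p0.
have pos r : a <= r -> 0 < r by exact: lt_le_trans.
have cf r : a <= r -> {for r, continuous (fun r => expR (- r) * (r `^ (- p) + p * r `^ (- p - 1)))}.
  move=> /pos r0; apply: cvgM.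
    by apply: continuous_comp; [exact: opp_continuous|exact: continuous_expR].
  apply: cvgD; first exact: continuous_powR.
  by apply: cvgM; [exact: cvg_cst|exact: continuous_powR].
have i0 q := integrable_expR_powR_y q a0.
have ii : mu.-integrable `]a, +oo[ (EFin \o (fun r => expR (- r) * (r `^ (- p) + p * r `^ (- p - 1)))).
  have i1 := integrableZl (measurable_itvR _) p (i0 (- p - 1)).
  have := integrableD (measurable_itvR _) (i0 (- p)) i1.
  apply: eq_integrable => //.
  by move=> r _ /=; rewrite -EFinM -EFinD; congr (_%:E); ring.
rewrite Rintegral_itv_obnd_cbnd//.
have d r : a <= r -> is_derive r 1 (fun r => - (expR (- r) * r `^ (- p)))
    (expR (- r) * (r `^ (- p) + p * r `^ (- p - 1))).
  move=> /pos r0; have dp := is_derive1_powR (- p) r0.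
  by apply: is_derive_eq; rewrite /GRing.scale/=; ring.
rewrite (@Rintegral_ge0_continuous_FTC2y _ _ (fun r => - (expR (- r) * r `^ (- p))) a 0).
- by rewrite sub0r opprK.
- by move=> r ar; rewrite mulr_ge0 ?expR_ge0// addr_ge0 ?powR_ge0// mulr_ge0// powR_ge0.
- apply: continuous_in_subspaceT => r /set_mem/=; rewrite in_itv/= andbT; exact: cf.
- rewrite -[X in _ --> X]oppr0; apply: cvgN.
  apply: (@squeeze_cvgr _ _ _ _ (fun=> 0) (fun r => expR (- r) * a `^ (- p))).
  + near=> r; rewrite mulr_ge0 ?expR_ge0 ?powR_ge0//= ler_wpM2l ?expR_ge0//.
    have ar : a <= r by near: r; apply: nbhs_pinfty_ge; exact: num_real.
    rewrite !powRN lef_pV2 ?posrE ?powR_gt0 ?(pos _ ar)//.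
    by apply: ge0_ler_powR; rewrite ?nnegrE ?(ltW a0) ?(ltW (pos _ ar)).
  + exact: cvg_cst.
  + rewrite -[X in _ --> X](mul0r (a `^ (- p))); apply: cvgM; last exact: cvg_cst.
    exact: cvgr_expR.
- by move=> r /ltW/d[].
- apply: cvg_at_right_filter; exact: is_derive_continuous (d _ (lexx a)).
- move=> r; rewrite in_itv/= andbT => /ltW/d dr.
  by rewrite derive1E derive_val.
Unshelve. all: by end_near. Qed.

Lemma Im_cpow0 p r : Im (cpow p r 0) = 0.
Proof. by rewrite /= mulr0 sin0 mulr0. Qed.

(** The arc of radius a is O(a^(1-b)), so the contour collapses onto the negative axis and leaves
    sin (b pi) Gamma(1 - b) / pi, which is 1 / Gamma(b) by reflection. *)
Lemma hankel_cpow_lt1 b a : 0 < b -> b < 1 -> 0 < a ->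
  Gamma_fun b * hankel (cpow (- b)) a = 1.
Proof.
move=> b0 b1 a0; have b1' : 0 < 1 - b by rewrite subr_gt0.
have i0 := integrable_gamma b1'.
have E r : expR (- r) * Im (cpow (- b) r pi) = - sin (b * pi) * gamma_integrand (1 - b) r.
  rewrite /= mulNr sinN /gamma_integrand (_ : 1 - b - 1 = - b); last by ring.
  by ring.
rewrite (hankel_limit (L := 0) a0 (fun r t h _ => hol_cpow (- b) t h)
  (fun r _ => Im_cpow0 (- b) r)).
- rewrite (funext E) RintegralZl// -[\int[mu]_(r in _) _]/(Gamma_fun (1 - b)).
  have H := Gamma_fun_reflection b0 b1.
  have pi0 : pi != 0 :> R by rewrite gt_eqF// pi_gt0.
  by apply: (mulIf pi0); rewrite mul1r -[RHS]H mulrA divfK//; ring.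
- rewrite (funext E); have := integrableZl (measurable_itvR _) (- sin (b * pi)) i0.
  by apply: eq_integrable => // r _ /=; rewrite EFinM.
- apply/norm_cvg0P; apply: (@squeeze_cvgr _ _ _ _ (fun=> 0)
    (fun n => (expR 1 * pi) * n.+1%:R^-1 `^ (1 - b))).
  + apply: nearW => n; rewrite normr_ge0/=.
    have n0 : 0 < n.+1%:R^-1 :> R by rewrite invr_gt0.
    apply: le_trans (hankel_arc_le (M := n.+1%:R^-1 `^ (- b)) n0 (powR_ge0 _ _)
      (fun t _ => hol_cpow (- b) t n0) _) _.
      by move=> t _; rewrite sqnorm_cpow.
    rewrite -mulrA [leRHS]mulrAC mulrA ler_wpM2r ?pi_ge0// -mulrA ler_pM ?expR_ge0 ?mulr_ge0 ?powR_ge0 ?(ltW n0)//.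
      by rewrite ler_expR invn_le1.
    by rewrite powRD ?powRr1 ?(ltW n0)//; apply/implyP; rewrite (gt_eqF n0).
  + exact: cvg_cst.
  + rewrite -[X in _ --> X](mulr0 (expR 1 * pi)); apply: cvgM; first exact: cvg_cst.
    exact: cvg_powR_harmonic.
Qed.

End hankel_gamma.

(** * Hankel's formula for every b > 0 *)

Section hankel_reciprocal_gamma.
Context {R : realType}.
Implicit Types (F G : R -> R -> R[i]) (a b c p q r t : R).
Notation mu := (@lebesgue_measure R).

(** For b = 1 the roles are exchanged: the ray carries sin pi = 0, while the kernel is e^z, which
    tends to 1, so that the arc tends to pi. *)
Lemma hankel_cpow1 a : 0 < a -> Gamma_fun 1 * hankel (cpow (- 1)) a = 1 :> R.
Proof.
move=> a0; rewrite Gamma_fun1 mul1r.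
have E r : expR (- r) * Im (cpow (- 1) r pi) = 0.
  by rewrite /= mulN1r sinN sinpi oppr0 !mulr0.
have i0 : mu.-integrable `]0, +oo[ (EFin \o (fun=> 0 : R)).
  exact: integrable0.
rewrite (hankel_limit (L := pi) a0 (fun r t h _ => hol_cpow (- 1) t h)
  (fun r _ => Im_cpow0 (- 1) r)).
- rewrite (funext E) (_ : Rintegral _ _ _ = 0) ?subr0 ?divff ?gt_eqF ?pi_gt0//.
  by rewrite /Rintegral integral0.
- by rewrite (funext E).
have kE (n : nat) t : Re (hankel_kernel (cpow (- 1)) n.+1%:R^-1 t) =
    expR (n.+1%:R^-1 * cos t) * cos (n.+1%:R^-1 * sin t).
  have n0 : 0 < n.+1%:R^-1 :> R by rewrite invr_gt0.
  rewrite /hankel_kernel cpowD// subrr cpow0 mulr1 /= powRr1 ?(ltW n0)//.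
  by rewrite !mul1r.
have -> : pi = \int[mu]_(t in `[0, pi]) (1 : R).
  rewrite Rintegral_cst//= lebesgue_measure_itv/= lte_fin pi_gt0.
  by rewrite mul1r -EFinB/= subr0.
have ci f : continuous f -> mu.-integrable `[0, pi] (EFin \o f).
  by move=> cf; apply: integrable_continuous_itv => t _; exact: cf.
rewrite /hankel_arc; apply: (cvg_Rintegral_dominated (g := fun=> expR 1)).
- exact: measurable_itvR.
- move=> n; rewrite (funext (kE n)); apply: ci => t; apply: cvgM.
    apply: continuous_comp; last exact: continuous_expR.
    by apply: cvgM; [exact: cvg_cst|exact: continuous_cos].
  apply: continuous_comp; last exact: continuous_cos.
  by apply: cvgM; [exact: cvg_cst|exact: continuous_sin].
- by apply: ci => t; exact: cvg_cst.
- by apply: ci => t; exact: cvg_cst.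
- move=> t _; rewrite (funext (fun n => kE n t)) /= -[X in _ --> X]mul1r; apply: cvgM.
    rewrite -[X in _ --> X]expR0; apply: continuous_cvg; first exact: continuous_expR.
    by rewrite -[X in _ --> X](mul0r (cos t)); apply: cvgM; [exact: cvg_harmonic|exact: cvg_cst].
  rewrite -[X in _ --> X]cos0; apply: continuous_cvg; first exact: continuous_cos.
  by rewrite -[X in _ --> X](mul0r (sin t)); apply: cvgM; [exact: cvg_harmonic|exact: cvg_cst].
- move=> n t _; rewrite kE normrM ger0_norm ?expR_ge0//.
  rewrite -[leRHS]mulr1 ler_pM ?expR_ge0//; last first.
    by rewrite ler_norml cos_geN1 cos_le1.
  rewrite ler_expR -[leRHS]mulr1 (@le_trans _ _ (n.+1%:R^-1 * 1))//.
    by rewrite ler_wpM2l ?invr_ge0// cos_le1.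
  by rewrite ler_wpM2r// invn_le1.
Qed.

Lemma integrable_hankel_ray_cpow p a : 0 < a ->
  mu.-integrable `]a, +oo[ (EFin \o (fun r => expR (- r) * Im (cpow p r pi))).
Proof.
move=> a0; have := integrableZl (measurable_itvR _) (sin (p * pi)) (integrable_expR_powR_y p a0).
by apply: eq_integrable => // r _ /=; rewrite -EFinM; congr (_%:E); ring.
Qed.

Lemma hankel_ray_cpow p a : 0 < a ->
  hankel_ray (cpow p) a = sin (p * pi) * \int[mu]_(r in `]a, +oo[) (expR (- r) * r `^ p).
Proof.
move=> a0; rewrite -RintegralZl//; last exact: integrable_expR_powR_y.
by apply: eq_Rintegral => r _ /=; ring.
Qed.

(** Integration by parts on the contour, whose radius stays fixed because the arc does not vanish at
    0 for these exponents. The arc and the ray meet at z = -a; both differences equal the boundary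
    term there, and they cancel in [hankel]. *)
Lemma hankel_cpowS b a : 0 < b -> 0 < a ->
  hankel (cpow (- b)) a = b * hankel (cpow (- b - 1)) a.
Proof.
move=> b0 a0.
have hf t := holM (hol_cexp (hol_cpow 1 t a0)) (hol_cpow (- b) t a0).
have ca p : mu.-integrable `[0, pi] (EFin \o (fun t => Re (hankel_kernel (cpow p) a t))).
  apply: integrable_continuous_itv.
  exact: (continuous_Re_hankel_kernel a0 (fun t _ => hol_cpow p t a0)).
have arcE : hankel_arc (cpow (- b)) a - b * hankel_arc (cpow (- b - 1)) a =
    - (sin (b * pi) * (expR (- a) * a `^ (- b))).
  have ibz : mu.-integrable `[0, pi] (EFin \o (fun t => b * Re (hankel_kernel (cpow (- b - 1)) a t))).
    apply: integrable_continuous_itv => t tp; apply: cvgM; first exact: cvg_cst.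
    exact: (continuous_Re_hankel_kernel a0 (fun t _ => hol_cpow (- b - 1) t a0)).
  rewrite /hankel_arc -RintegralZl//.
  rewrite -RintegralB//.
  (* On the circle d/dt (e^z z^-b) = i (z e^z z^-b - b e^z z^-b), and z^-b = z z^(-b-1) turns the
     last term into the kernel of exponent - b - 1. *)
  rewrite (@Rintegral_FTC _ _ (fun t => Im (cexp (cpow 1 a t) * cpow (- b) a t))).
  - rewrite !ImM /= !mul1r sinpi cospi sin0 cos0 !mulr0 sin0 powRr1 ?(ltW a0)//.
    by rewrite !(mulr0, sin0, cos0, mul0r, addr0, mulrN1, mulr1) mulNr sinN; ring.
  - exact: pi_ge0.
  - move=> t _; have [_ _ _ d _ _ _ _] := hf t.
    apply: is_derive_eq; rewrite /hankel_kernel [cpow 1 a t * cpow (- b - 1) a t]cpowD//.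
    rewrite (_ : 1 + (- b - 1) = - b); last by ring.
    by rewrite ReD !ReM !ImM /=; ring.
  - move=> t tp; apply: cvgB.
      exact: (continuous_Re_hankel_kernel a0 (fun t _ => hol_cpow (- b) t a0)).
    apply: cvgM; first exact: cvg_cst.
    exact: (continuous_Re_hankel_kernel a0 (fun t _ => hol_cpow (- b - 1) t a0)).
have rayE : hankel_ray (cpow (- b)) a - b * hankel_ray (cpow (- b - 1)) a =
    - (sin (b * pi) * (expR (- a) * a `^ (- b))).
  rewrite !hankel_ray_cpow// -Rintegral_expR_powR_y ?(ltW b0)//.
  have -> : sin ((- b - 1) * pi) = sin (b * pi).
    by rewrite mulrBl mul1r mulNr -opprD sinN sinDpi opprK.
  rewrite mulNr sinN.
  have i1 := integrable_expR_powR_y (- b) a0.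
  have i2 := integrable_expR_powR_y (- b - 1) a0.
  have i3 : mu.-integrable `]a, +oo[ (EFin \o (fun r => b * (expR (- r) * r `^ (- b - 1)))).
    have := integrableZl (measurable_itvR _) b i2.
    by apply: eq_integrable => // r _ /=; rewrite EFinM.
  have -> : \int[mu]_(r in `]a, +oo[) (expR (- r) * (r `^ (- b) + b * r `^ (- b - 1))) =
    \int[mu]_(r in `]a, +oo[) (expR (- r) * r `^ (- b)) +
    b * \int[mu]_(r in `]a, +oo[) (expR (- r) * r `^ (- b - 1)).
    rewrite -RintegralZl// -RintegralD//.
    by apply: eq_Rintegral => r _ /=; ring.
  by ring.
rewrite /hankel mulrA; congr (_ / _).
rewrite mulrBr; move: arcE rayE.
move: (hankel_arc (cpow (- b)) a) (b * hankel_arc _ _) (hankel_ray (cpow (- b)) a).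
by move: (b * hankel_ray _ _) (- (_ * _)) => u v w z k; lra.
Qed.

(** [Gamma_funS] and [hankel_cpowS] carry the same factor b on opposite sides, so the product is
    unchanged by b |-> b + 1; induction on an integer bound for b reduces to (0, 1]. *)
Theorem hankel_Gamma b a : 0 < b -> 0 < a -> Gamma_fun b * hankel (cpow (- b)) a = 1.
Proof.
move=> + a0; suff H (n : nat) c : 0 < c -> c <= n.+1%:R ->
    Gamma_fun c * hankel (cpow (- c)) a = 1.
  by move=> b0; apply: (H (Num.truncn b)) => //; exact/ltW/truncnS_gt.
elim: n c => [|n IH] c c0.
  rewrite le_eqVlt => /predU1P[->|c1]; first exact: hankel_cpow1.
  exact: hankel_cpow_lt1.
move=> cn; have [c1|c1] := leP c 1; first by apply: IH => //; rewrite (le_trans c1)// ler1n.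
have d0 : 0 < c - 1 by rewrite subr_gt0.
have cE : c = (c - 1) + 1 by rewrite subrK.
rewrite [in Gamma_fun c]cE Gamma_funS//.
have := IH (c - 1) d0; rewrite lerBlDr natr1 => /(_ cn).
rewrite hankel_cpowS// (_ : - (c - 1) - 1 = - c); last by ring.
by rewrite mulrA [Gamma_fun _ * _]mulrC.
Qed.

End hankel_reciprocal_gamma.

(** * Linearity and continuity of the contour integral *)

Section hankel_linear.
Context {R : realType}.
Implicit Types (F G : R -> R -> R[i]) (a b c p q r t : R).
Notation mu := (@lebesgue_measure R).

Definition hankel_integrable F a :=
  mu.-integrable `[0, pi] (EFin \o (fun t => Re (hankel_kernel F a t))) /\
  mu.-integrable `]a, +oo[ (EFin \o (fun r => expR (- r) * Im (F r pi))).

Lemma hankel_integrable_cpow p a : 0 < a -> hankel_integrable (cpow p) a.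
Proof.
move=> a0; split; last exact: integrable_hankel_ray_cpow.
apply: integrable_continuous_itv.
exact: (continuous_Re_hankel_kernel a0 (fun t _ => hol_cpow p t a0)).
Qed.

Lemma Re_hankel_kernelD F G r t :
  Re (hankel_kernel (fun r t => F r t + G r t) r t) =
  Re (hankel_kernel F r t) + Re (hankel_kernel G r t).
Proof. by rewrite /hankel_kernel !mulrDr ReD. Qed.

Lemma Re_hankel_kernelZ c F r t :
  Re (hankel_kernel (fun r t => c%:C * F r t) r t) = c * Re (hankel_kernel F r t).
Proof.
rewrite /hankel_kernel [cpow 1 r t * _]mulrCA [cexp _ * _]mulrCA.
by rewrite [Re (c%:C * _)]ReM /= mul0r subr0.
Qed.

Lemma hankel_integrableD F G a : hankel_integrable F a -> hankel_integrable G a ->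
  hankel_integrable (fun r t => F r t + G r t) a.
Proof.
move=> [iF jF] [iG jG]; split.
- have := integrableD (measurable_itvR _) iF iG.
  by apply: eq_integrable => // t _ /=; rewrite -EFinD Re_hankel_kernelD.
- have := integrableD (measurable_itvR _) jF jG.
  by apply: eq_integrable => // r _ /=; rewrite -EFinD ImD mulrDr.
Qed.

Lemma hankel_integrableZ c F a : hankel_integrable F a ->
  hankel_integrable (fun r t => c%:C * F r t) a.
Proof.
move=> [iF jF]; split.
- have := integrableZl (measurable_itvR _) c iF.
  by apply: eq_integrable => // t _ /=; rewrite -EFinM Re_hankel_kernelZ.
- have := integrableZl (measurable_itvR _) c jF.
  apply: eq_integrable => // r _ /=; rewrite -EFinM ImM /= mul0r addr0.
  by rewrite mulrCA.
Qed.

Lemma hankelD F G a : hankel_integrable F a -> hankel_integrable G a ->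
  hankel (fun r t => F r t + G r t) a = hankel F a + hankel G a.
Proof.
move=> [iF jF] [iG jG]; rewrite /hankel -mulrDl; congr (_ / _).
have -> : hankel_arc (fun r t => F r t + G r t) a = hankel_arc F a + hankel_arc G a.
  by rewrite /hankel_arc -RintegralD//; apply: eq_Rintegral => t _; exact: Re_hankel_kernelD.
have -> : hankel_ray (fun r t => F r t + G r t) a = hankel_ray F a + hankel_ray G a.
  by rewrite /hankel_ray -RintegralD//; apply: eq_Rintegral => t _; rewrite ImD mulrDr.
by rewrite opprD addrACA.
Qed.

Lemma hankelZ c F a : hankel_integrable F a ->
  hankel (fun r t => c%:C * F r t) a = c * hankel F a.
Proof.
move=> [iF jF]; rewrite /hankel mulrA; congr (_ / _).
have -> : hankel_arc (fun r t => c%:C * F r t) a = c * hankel_arc F a.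
  by rewrite /hankel_arc -RintegralZl//; apply: eq_Rintegral => t _; exact: Re_hankel_kernelZ.
have -> : hankel_ray (fun r t => c%:C * F r t) a = c * hankel_ray F a.
  rewrite /hankel_ray -RintegralZl//; apply: eq_Rintegral => t _.
  by rewrite ImM /= mul0r addr0 mulrCA.
by rewrite mulrBr.
Qed.

Lemma eq_hankel F G a : (forall r t, F r t = G r t) -> hankel F a = hankel G a.
Proof.
by move=> FG; rewrite (_ : F = G)//; apply/funext => r; apply/funext => t.
Qed.

Lemma hankel_integrable_sum (c e : nat -> R) a n : 0 < a ->
  hankel_integrable (fun r t => \sum_(k < n) (c k)%:C * cpow (e k) r t) a.
Proof.
move=> a0; elim: n => [|n IH].
  have := hankel_integrableZ 0 (hankel_integrable_cpow 0 a0).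
  rewrite (_ : (fun _ _ => _) = (fun r t => \sum_(k < 0) (c k)%:C * cpow (e k) r t))//.
  by apply/funext => r; apply/funext => t; rewrite big_ord0 mul0r.
have := hankel_integrableD IH (hankel_integrableZ (c n) (hankel_integrable_cpow (e n) a0)).
rewrite (_ : (fun _ _ => _ + _) = (fun r t => \sum_(k < n.+1) (c k)%:C * cpow (e k) r t))//.
by apply/funext => r; apply/funext => t; rewrite big_ord_recr.
Qed.

Lemma hankel_sum (c e : nat -> R) a n : 0 < a ->
  hankel (fun r t => \sum_(k < n) (c k)%:C * cpow (e k) r t) a =
  \sum_(k < n) c k * hankel (cpow (e k)) a.
Proof.
move=> a0; elim: n => [|n IH].
  rewrite big_ord0 -[RHS](mul0r (hankel (cpow 0) a)) -hankelZ; last exact: hankel_integrable_cpow.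
  by apply: eq_hankel => r t; rewrite big_ord0 mul0r.
rewrite big_ord_recr /= -IH -hankelZ; last exact: hankel_integrable_cpow.
rewrite -hankelD; [|exact: hankel_integrable_sum|exact/hankel_integrableZ/hankel_integrable_cpow].
by apply: eq_hankel => r t; rewrite big_ord_recr.
Qed.

(** The constant depends on a alone: |e^z| <= e^a on the arc gives e^a a pi, and the ray gives e^-a
    <= 1. Hence uniform convergence on the contour implies convergence of the contour integrals. *)
Lemma hankel_le F a M : 0 < a -> 0 <= M -> hankel_integrable F a ->
  (forall r t, a <= r -> 0 <= t <= pi -> sqnorm (F r t) <= M ^+ 2) ->
  `|hankel F a| <= M * ((expR a * a * pi + 1) / pi).
Proof.
move=> a0 M0 [iF jF] FM.
rewrite /hankel normrM [`|pi^-1|]ger0_norm ?invr_ge0 ?pi_ge0// mulrA.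
rewrite ler_wpM2r ?invr_ge0 ?pi_ge0// (le_trans (ler_normB _ _))// mulrDr mulr1 lerD//.
- apply: le_trans (le_normr_Rintegral _ iF) _ => //.
  have ic : mu.-integrable `[0, pi] (EFin \o (fun=> expR a * a * M)).
    by apply: integrable_continuous_itv => t _; exact: cvg_cst.
  apply: (@le_trans _ _ (\int[mu]_(t in `[0, pi]) cst (expR a * a * M) t)).
    apply: le_Rintegral => //; first exact: integrable_norm.
    move=> t /=; rewrite in_itv/= => t0; apply: Re_hankel_kernel_le => //.
    exact: FM.
  rewrite Rintegral_cst//= lebesgue_measure_itv/= lte_fin pi_gt0.
  rewrite -EFinB/= subr0; move: (pi) => y.
  by rewrite (_ : M * (expR a * a * y) = expR a * a * M * y)//; ring.
- apply: le_trans (le_normr_Rintegral _ jF) _ => //.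
  have i1 := integrable_expR_powR_y 0 a0.
  have i2 : mu.-integrable `]a, +oo[ (EFin \o (fun r => M * (expR (- r) * r `^ 0))).
    have := integrableZl (measurable_itvR _) M i1.
    by apply: eq_integrable => // r _ /=; rewrite EFinM.
  apply: (@le_trans _ _ (\int[mu]_(r in `]a, +oo[) (M * (expR (- r) * r `^ 0)))).
    apply: le_Rintegral => //; first exact: integrable_norm.
    move=> r /=; rewrite in_itv/= andbT => ar.
    rewrite normrM ger0_norm ?expR_ge0// powRr0 mulr1 mulrC ler_wpM2r ?expR_ge0//.
    apply: Im_le => //; apply: FM; first exact: ltW.
    by rewrite pi_ge0 lexx.
  rewrite RintegralZl//.
  have -> : \int[mu]_(r in `]a, +oo[) (expR (- r) * r `^ 0) = expR (- a).
    rewrite -[RHS]mulr1 -(powRr0 a) -[X in a `^ X]oppr0 -(Rintegral_expR_powR_y a0 (lexx 0)).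
    by apply: eq_Rintegral => r _; rewrite oppr0 mul0r addr0.
  by rewrite ler_piMr// -expR0 ler_expR oppr_le0 ltW.
Qed.

End hankel_linear.

(** * The spectral representation *)

Section spectral_representation.
Context {R : realType}.
Variable nu : R.
Hypotheses (nu_gt0 : 0 < nu) (nu_lt1 : nu < 1).
Implicit Types (a b c r t x : R).
Notation mu := (@lebesgue_measure R).

(** Equal to cos^2 (nu pi/2), and positive because nu < 1: it measures how far z^nu stays from the
    negative axis. *)
Definition kappa := (1 + cos (nu * pi)) / 2.

Lemma kappa_gt0 : 0 < kappa.
Proof.
rewrite divr_gt0// -ltrBlDl sub0r -cospi ltr_cos ?in_itv/=.
- by rewrite gtr_pMl// pi_gt0.
- by rewrite mulr_ge0 ?pi_ge0 ?(ltW nu_gt0)// ler_piMl ?pi_ge0// ltW.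
- by rewrite pi_ge0 lexx.
Qed.

Definition resolvent x r t : R[i] := cpow nu r t + x%:C.

(** With w = r^nu and k = cos (nu pi) <= cos (nu t), the left side is at most w^2 + 2 w x k + x^2,
    since the difference of these two is (1 - k)/2 (w - x)^2. *)
Lemma sqnorm_resolvent_ge x r t : 0 < x -> 0 <= t <= pi ->
  kappa * (r `^ nu + x) ^+ 2 <= sqnorm (resolvent x r t).
Proof.
move=> x0 /andP[t0 tp]; rewrite /sqnorm /= addr0 /kappa.
have cc : cos (nu * pi) <= cos (nu * t).
  have nt0 : 0 <= nu * t by rewrite mulr_ge0// ltW.
  have ntp : nu * t <= nu * pi by rewrite ler_wpM2l// ltW.
  have npp : nu * pi <= pi by rewrite ler_piMl ?pi_ge0// ltW.
  have [->//|ne] := eqVneq (nu * t) (nu * pi).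
  apply: ltW; rewrite ltr_cos ?in_itv/= ?nt0 ?npp ?(le_trans ntp)// ?(le_trans nt0)//.
  by rewrite lt_neqAle ne.
have := cos2Dsin2 (nu * t); have := cos_le1 (nu * t).
have := powR_ge0 r nu.
move: (cos (nu * pi)) (cos (nu * t)) (sin _) (r `^ nu) cc => k c s w kc w0 c1 cs.
have -> : (w * c + x) ^+ 2 + (w * s) ^+ 2 = w ^+ 2 + 2 * w * x * c + x ^+ 2.
  transitivity (w ^+ 2 * (c ^+ 2 + s ^+ 2) + 2 * w * x * c + x ^+ 2); first by ring.
  by rewrite cs mulr1.
have wx : 0 <= w * x by rewrite mulr_ge0// ltW.
have := ler_wpM2l wx kc => h1.
have k1 : k <= 1 by exact: le_trans c1.
have : 0 <= (1 - k) * (w - x) ^+ 2 by rewrite mulr_ge0 ?sqr_ge0// subr_ge0.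
nra.
Qed.

Lemma resolvent_neq0 x r t : 0 < x -> 0 <= t <= pi -> resolvent x r t != 0.
Proof.
move=> x0 t0; rewrite -sqnorm_eq0 gt_eqF//.
apply: lt_le_trans (sqnorm_resolvent_ge r x0 t0).
by rewrite mulr_gt0 ?kappa_gt0// exprn_gt0// ltr_wpDl ?powR_ge0.
Qed.

Definition resolvent2 x r t : R[i] := (resolvent x r t)^-1 * (resolvent x r t)^-1.

Lemma hol_resolvent x r t : 0 < r ->
  hol (resolvent x) (fun r t => nu%:C * cpow nu r t + 0) r t.
Proof. by move=> r0; exact: (holD (hol_cpow nu t r0) (hol_cst x%:C r t)). Qed.

(** The derivative z d/dz of [resolvent2], left in the unsimplified form produced by [holM] and
    [holV]. *)
Definition resolvent2' x r t : R[i] :=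
  - ((nu%:C * cpow nu r t + 0) * ((resolvent x r t)^-1 * (resolvent x r t)^-1)) * (resolvent x r t)^-1 +
  (resolvent x r t)^-1 * - ((nu%:C * cpow nu r t + 0) * ((resolvent x r t)^-1 * (resolvent x r t)^-1)).

Lemma hol_resolvent2 x r t : 0 < x -> 0 < r -> 0 <= t <= pi ->
  hol (resolvent2 x) (resolvent2' x) r t.
Proof.
move=> x0 r0 t0; have hV := holV (resolvent_neq0 r x0 t0) (hol_resolvent x t r0).
exact: (holM hV hV).
Qed.

Lemma sqnorm_resolvent2_le x r t : 0 < x -> 0 <= t <= pi ->
  sqnorm (resolvent2 x r t) <= (kappa * (r `^ nu + x) ^+ 2)^-1 ^+ 2.
Proof.
move=> x0 t0; rewrite sqnormM -expr2 sqnormV.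
have k0 : 0 < kappa * (r `^ nu + x) ^+ 2.
  by rewrite mulr_gt0 ?kappa_gt0// exprn_gt0// ltr_wpDl ?powR_ge0.
have n0 := lt_le_trans k0 (sqnorm_resolvent_ge r x0 t0).
rewrite ler_sqr ?nnegrE ?invr_ge0 ?(ltW k0) ?(ltW n0)//.
by rewrite lef_pV2 ?posrE// sqnorm_resolvent_ge.
Qed.

Lemma sqnorm_resolvent2_le_cst x r t : 0 < x -> 0 <= t <= pi ->
  sqnorm (resolvent2 x r t) <= (kappa * x ^+ 2)^-1 ^+ 2.
Proof.
move=> x0 t0; apply: le_trans (sqnorm_resolvent2_le r x0 t0) _.
have w0 := powR_ge0 r nu.
have k0 : 0 < kappa * (r `^ nu + x) ^+ 2.
  by rewrite mulr_gt0 ?kappa_gt0// exprn_gt0// ltr_wpDl.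
have k1 : 0 < kappa * x ^+ 2 by rewrite mulr_gt0 ?kappa_gt0// exprn_gt0.
rewrite ler_sqr ?nnegrE ?invr_ge0 ?(ltW k0) ?(ltW k1)//.
rewrite lef_pV2 ?posrE// ler_wpM2l ?(ltW kappa_gt0)//.
by rewrite ler_sqr ?nnegrE ?(ltW x0) ?addr_ge0 ?(ltW x0)// lerDr.
Qed.

Lemma Im_resolvent2_0 x r : Im (resolvent2 x r 0) = 0.
Proof.
rewrite /resolvent2 /resolvent ImM !ImV !ImD /= mulr0 sin0 mulr0 addr0.
by rewrite !mul0r oppr0 mulr0 mul0r addr0.
Qed.

Definition spectral_density x r := - Im (resolvent2 x r pi).

Lemma spectral_densityE x r : 0 < x -> spectral_density x r =
  2 * (r `^ nu * sin (nu * pi)) * (r `^ nu * cos (nu * pi) + x) /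
  sqnorm (resolvent x r pi) ^+ 2.
Proof.
move=> x0; have := resolvent_neq0 r x0 (introT andP (conj (pi_ge0 R) (lexx _))).
rewrite -sqnorm_eq0 /spectral_density /resolvent2 ImM ReV ImV -/(sqnorm _).
move=> n0.
have -> : Re (resolvent x r pi) = r `^ nu * cos (nu * pi) + x by [].
have -> : Im (resolvent x r pi) = r `^ nu * sin (nu * pi) by rewrite /= addr0.
by field.
Qed.

Lemma continuous_spectral_density x r : 0 < x -> 0 < r ->
  {for r, continuous (spectral_density x)}.
Proof.
move=> x0 r0.
have [_ _ _ _ _ c _ _] := hol_resolvent2 x0 r0 (introT andP (conj (pi_ge0 R) (lexx _))).
by apply: cvgN; exact: (cont2_r c).
Qed.

Lemma spectral_density_le_cst x r : 0 < x ->
  `|spectral_density x r| <= (kappa * x ^+ 2)^-1.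
Proof.
move=> x0; rewrite normrN; apply: Im_le.
  by rewrite invr_ge0 mulr_ge0 ?(ltW kappa_gt0)// sqr_ge0.
by apply: sqnorm_resolvent2_le_cst => //; rewrite pi_ge0 lexx.
Qed.

Lemma integrable_spectral x : 0 < x ->
  mu.-integrable `]0, +oo[ (EFin \o (fun r => expR (- r) * spectral_density x r)).
Proof.
move=> x0; have := integrableZl (measurable_itvR _) (kappa * x ^+ 2)^-1 (integrable_gamma (@ltr01 R)).
apply: le_integrable; first exact: measurable_itvR.
  apply/measurable_EFinP; apply: measurable_continuous_gt0 => r r0.
  apply: cvgM; last exact: continuous_spectral_density.
  by apply: continuous_comp; [exact: opp_continuous|exact: continuous_expR].
move=> r _ /=; rewrite lee_fin /gamma_integrand subrr powRr0 mul1r !normrM mulrC.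
rewrite ler_wpM2r// (le_trans (spectral_density_le_cst r x0))//.
exact: ler_norm.
Qed.

(** Near 0 the function is bounded by (kappa x^2)^-1, so an arc of radius a is O(a) and only the
    negative axis remains in the limit. *)
Lemma hankel_resolvent2 x a : 0 < x -> 0 < a ->
  hankel (resolvent2 x) a =
  (\int[mu]_(r in `]0, +oo[) (expR (- r) * spectral_density x r)) / pi.
Proof.
move=> x0 a0; have iS := integrable_spectral x0.
have E r : expR (- r) * Im (resolvent2 x r pi) = - 1 * (expR (- r) * spectral_density x r).
  by rewrite /spectral_density; ring.
have iI : mu.-integrable `]0, +oo[ (EFin \o (fun r => expR (- r) * Im (resolvent2 x r pi))).
  rewrite (funext E); have := integrableZl (measurable_itvR _) (- 1) iS.
  by apply: eq_integrable => // r _ /=; rewrite EFinM.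
rewrite (hankel_limit (L := 0) a0 (fun r t h1 h2 => hol_resolvent2 x0 h1 h2)
  (fun r _ => Im_resolvent2_0 x r) iI).
  by rewrite (funext E) RintegralZl// mulN1r sub0r opprK.
apply/norm_cvg0P; apply: (@squeeze_cvgr _ _ _ _ (fun=> 0)
    (fun n => (expR 1 * (kappa * x ^+ 2)^-1 * pi) * n.+1%:R^-1)).
- apply: nearW => n; rewrite normr_ge0/=.
  have n0 : 0 < n.+1%:R^-1 :> R by rewrite invr_gt0.
  have K0 : 0 <= (kappa * x ^+ 2)^-1.
    by rewrite invr_ge0 mulr_ge0 ?(ltW kappa_gt0)// sqr_ge0.
  apply: le_trans (hankel_arc_le n0 K0 (fun t h => hol_resolvent2 x0 n0 h)
    (fun t h => sqnorm_resolvent2_le_cst _ x0 h)) _.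
  move: K0; move: (kappa * x ^+ 2)^-1 => K K0.
  rewrite [leRHS]mulrC !mulrA ler_wpM2r ?pi_ge0// ler_wpM2r//.
  by rewrite [leLHS]mulrC ler_wpM2l ?(ltW n0)// ler_expR invn_le1.
- exact: cvg_cst.
- rewrite -[X in _ --> X](mulr0 (expR 1 * (kappa * x ^+ 2)^-1 * pi)).
  by apply: cvgM; [exact: cvg_cst|exact: cvg_harmonic].
Qed.

End spectral_representation.

(** * The Mittag-Leffler series as a limit of contour integrals *)

Section mittag_leffler_series.
Context {R : realType}.
Variable nu : R.
Hypotheses (nu_gt0 : 0 < nu) (nu_lt1 : nu < 1).
Implicit Types (a b c r t x : R).
Notation mu := (@lebesgue_measure R).

(** Hence (2)_n / n! = n + 1, the coefficients of (1 - y)^-2: this is where the square of the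
    resolvent comes from. *)
Lemma pochhammer2 n : pochhammer (2 : R) n = n.+1`!%:R.
Proof.
elim: n => [|n IH]; first by rewrite /pochhammer big_geq.
rewrite /pochhammer big_nat_recr//= -/(pochhammer 2 n) IH.
by rewrite [in RHS]factS natrM mulrC -natrD.
Qed.

Definition ml_coef (n : nat) : R :=
  pochhammer 2 n / (n`!%:R * Gamma_fun (nu * n%:R + 2 * nu)).

Lemma ml_argument_gt0 (n : nat) : 0 < nu * n%:R + 2 * nu.
Proof. by rewrite ltr_wpDl ?mulr_ge0 ?mulr_gt0// ltW. Qed.

(** The radius a is free, so one contour, chosen later in terms of x, serves all coefficients at
    once. *)
Lemma ml_coefE n a : 0 < a ->
  ml_coef n = n.+1%:R * hankel (cpow (- (nu * n%:R + 2 * nu))) a.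
Proof.
move=> a0; have H := hankel_Gamma (ml_argument_gt0 n) a0.
have G0 : Gamma_fun (nu * n%:R + 2 * nu) != 0.
  by apply/eqP => G0; move: H; rewrite G0 mul0r => /esym/eqP; rewrite oner_eq0.
rewrite /ml_coef pochhammer2 factS natrM.
apply: (mulIf G0); rewrite -[RHS]mulrA [hankel _ _ * _]mulrC H mulr1.
by field; rewrite G0 pnatr_eq0 -lt0n fact_gt0.
Qed.

(** A partial sum of the expansion of (z^nu + x)^-2 in powers of x z^-nu. *)
Definition ml_partial x n r t : R[i] :=
  \sum_(k < n) (k.+1%:R * (- x) ^+ k)%:C * cpow (- (nu * k%:R + 2 * nu)) r t.

Lemma pseries_ml_hankel x n a : 0 < a ->
  pseries ml_coef (- x) n = hankel (ml_partial x n) a.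
Proof.
move=> a0; rewrite /pseries /series/= big_mkord (hankel_sum (fun k => k.+1%:R * (- x) ^+ k) (fun k => - (nu * k%:R + 2 * nu)) n a0).
by apply: eq_bigr => k _; rewrite (ml_coefE k a0) mulrAC.
Qed.

Lemma cpowX p k r t : 0 < r -> cpow p r t ^+ k = cpow (p * k%:R) r t :> R[i].
Proof.
move=> r0; elim: k => [|k IH]; first by rewrite expr0 mulr0 cpow0.
by rewrite exprS IH cpowD// -natr1 mulrDr mulr1 addrC.
Qed.

(** The expansion of (1 + y)^-2 cut at order n, with its exact remainder and cleared of
    denominators. *)
Lemma sum_geometric2 (C : comNzRingType) (y : C) n :
  (1 + y) ^+ 2 * (\sum_(k < n) k.+1%:R * (- y) ^+ k) =
  1 - (- y) ^+ n * (n.+1%:R + n%:R * y).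
Proof.
elim: n => [|n IH].
  by rewrite big_ord0 mulr0 expr0 mul0r addr0 mul1r subrr.
by rewrite big_ord_recr/= mulrDr IH [in RHS]exprS -!natr1; move: ((- y) ^+ n) => z; ring.
Qed.

Lemma ml_partialE x n r t : 0 < r ->
  ml_partial x n r t = cpow (- nu) r t ^+ 2 *
    (\sum_(k < n) k.+1%:R * (- (x%:C * cpow (- nu) r t)) ^+ k).
Proof.
move=> r0; rewrite /ml_partial big_distrr/=; apply: eq_bigr => k _.
rewrite rmorphM rmorph_nat rmorphXn rmorphN /= -mulNr exprMn !cpowX//.
rewrite (_ : - (nu * k%:R + 2 * nu) = (- nu * 2%:R) + (- nu * k%:R)); last by ring.
by rewrite -cpowD//; ring.
Qed.

(** With y = x z^-nu, (z^nu + x) z^-nu = 1 + y, so the remainder of [sum_geometric2] is multiplied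
    by the squared resolvent. *)
Lemma resolvent2_sub_ml_partial x n r t : 0 < x -> 0 < r -> 0 <= t <= pi ->
  resolvent2 nu x r t - ml_partial x n r t =
  resolvent2 nu x r t * ((- (x%:C * cpow (- nu) r t)) ^+ n *
    (n.+1%:R + n%:R * (x%:C * cpow (- nu) r t))).
Proof.
move=> x0 r0 t0; have U0 := resolvent_neq0 nu_gt0 nu_lt1 r x0 t0.
rewrite ml_partialE//; have := sum_geometric2 (x%:C * cpow (- nu) r t) n.
set S := \sum_(k < n) _; set y := x%:C * _; set z := cpow _ r t => H.
have wz : cpow nu r t * z = 1 by rewrite cpowD// subrr cpow0.
have UE : resolvent nu x r t * z = 1 + y by rewrite mulrDl wz.
have -> : z ^+ 2 * S = resolvent2 nu x r t * ((1 + y) ^+ 2 * S).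
  rewrite -UE /resolvent2 exprMn; move: U0; move: (resolvent nu x r t) => U U0.
  by field.
by rewrite H; ring.
Qed.

Lemma sqnorm_real_addr (c d : R) (y : R[i]) : 0 <= c -> 0 <= d -> sqnorm y <= 1 ->
  sqnorm (c%:C + d%:C * y) <= (c + d) ^+ 2.
Proof.
move=> c0 d0; case: y => u v; rewrite /sqnorm /= => h.
have u1 : u <= 1 by have := sqr_ge0 v; nra.
have cd : 0 <= c * d by rewrite mulr_ge0.
have d2 : 0 <= d ^+ 2 by rewrite sqr_ge0.
have h1 := ler_wpM2l d2 h; have h2 := ler_wpM2l cd u1.
nra.
Qed.

Lemma sqnormX (y : R[i]) n : sqnorm (y ^+ n) = sqnorm y ^+ n.
Proof.
elim: n => [|n IH]; first by rewrite !expr0 /sqnorm/= expr1n expr0n addr0.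
by rewrite !exprS sqnormM IH.
Qed.

Lemma sqnormN (y : R[i]) : sqnorm (- y) = sqnorm y.
Proof. by case: y => u v; rewrite /sqnorm/= !sqrrN. Qed.

(** From a^nu = 4 x and |z| >= a follows |y| <= 1/4. The value 1/4 leaves room for the linear
    factor: |n + 1 + n y| <= 2 n + 1 <= 3 2^n, hence a remainder of at most 3 2^-n. *)
Lemma sqnorm_resolvent2_sub_ml_partial x n a r t :
  0 < x -> a `^ nu = 4 * x -> 0 < a -> a <= r -> 0 <= t <= pi ->
  sqnorm (resolvent2 nu x r t - ml_partial x n r t) <=
  ((kappa nu * x ^+ 2)^-1 * (3 * 2^-1 ^+ n)) ^+ 2.
Proof.
move=> x0 ax a0 ar t0; have r0 := lt_le_trans a0 ar.
rewrite resolvent2_sub_ml_partial// sqnormM exprMn ler_pM ?sqnorm_ge0//.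
  exact: sqnorm_resolvent2_le_cst.
set y := x%:C * cpow (- nu) r t.
have ySq : sqnorm y <= (4^-1) ^+ 2.
  rewrite sqnormM sqnorm_cpow (_ : sqnorm x%:C = x ^+ 2); last first.
    by rewrite /sqnorm/= expr0n addr0.
  rewrite -exprMn ler_sqr ?nnegrE ?mulr_ge0 ?powR_ge0 ?(ltW x0)// powRN.
  rewrite ler_pdivrMr ?powR_gt0// ler_pdivlMl// -ax.
  by apply: ge0_ler_powR; rewrite ?nnegrE ?(ltW nu_gt0) ?(ltW a0) ?(ltW r0).
have y1 : sqnorm y <= 1 by apply: le_trans ySq _; lra.
rewrite sqnormM sqnormX sqnormN.
have -> : n.+1%:R + n%:R * y = (n.+1%:R)%:C + (n%:R)%:C * y.
  by rewrite !rmorph_nat.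
have h := sqnorm_real_addr (ler0n _ n.+1) (ler0n _ n) y1.
apply: (@le_trans _ _ ((4^-1 ^+ 2) ^+ n * (n.+1%:R + n%:R) ^+ 2)).
  by rewrite ler_pM ?exprn_ge0 ?sqnorm_ge0// lerXn2r// nnegrE ?sqnorm_ge0// sqr_ge0.
rewrite exprAC -exprMn ler_sqr ?nnegrE ?mulr_ge0 ?exprn_ge0 ?addr_ge0//.
have -> : 4^-1 ^+ n = 2^-1 ^+ n * 2^-1 ^+ n :> R.
  by rewrite -exprMn; congr (_ ^+ n); field.
rewrite -mulrA mulrC ler_wpM2r ?exprn_ge0//.
rewrite exprVn ler_pdivrMl ?exprn_gt0// -natrD -natrX -natrM ler_nat.
have := ltn_expl n (isT : (1 < 2)%N); lia.
Qed.

Lemma hankel_integrable_resolvent2 x a : 0 < x -> 0 < a ->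
  hankel_integrable (resolvent2 nu x) a.
Proof.
move=> x0 a0; split.
  apply: integrable_continuous_itv.
  exact: (continuous_Re_hankel_kernel a0 (fun t h => hol_resolvent2 nu_gt0 nu_lt1 x0 a0 h)).
have S : `]a, +oo[ `<=` `]0, +oo[ by apply: subset_itvr; rewrite bnd_simp ltW.
have := integrableS (measurable_itvR _) (measurable_itvR _) S (integrable_spectral nu_gt0 nu_lt1 x0).
move=> /(integrableZl (measurable_itvR _) (- 1)).
apply: eq_integrable => // r _; rewrite -EFinM /spectral_density.
by rewrite mulrN mulN1r opprK.
Qed.

(** On the circle of radius a with a^nu = 4 x, [hankel_le] turns the uniform remainder into a bound
    C 2^-n for the distance between the partial sum and the contour integral of the squared
    resolvent. *)
Lemma cvg_pseries_ml x : 0 < x ->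
  pseries ml_coef (- x) @ \oo -->
  (\int[mu]_(r in `]0, +oo[) (expR (- r) * spectral_density nu x r)) / pi.
Proof.
move=> x0; pose a := (4 * x) `^ nu^-1.
have x40 : 0 < 4 * x by rewrite mulr_gt0.
have a0 : 0 < a by exact: powR_gt0.
have ax : a `^ nu = 4 * x.
  by rewrite -powRrM mulVf ?gt_eqF// powRr1// ltW.
rewrite -(hankel_resolvent2 nu_gt0 nu_lt1 x0 a0).
have -> : pseries ml_coef (- x) = (fun n => hankel (ml_partial x n) a).
  by apply/funext => n; exact: pseries_ml_hankel.
pose K := (kappa nu * x ^+ 2)^-1.
have K0 : 0 <= K by rewrite invr_ge0 mulr_ge0 ?sqr_ge0// ltW// kappa_gt0.
pose C := (expR a * a * pi + 1) / pi : R.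
have D n : `|hankel (resolvent2 nu x) a - hankel (ml_partial x n) a| <= K * (3 * 2^-1 ^+ n) * C.
  have ip : hankel_integrable (ml_partial x n) a.
    exact: (hankel_integrable_sum (fun k => k.+1%:R * (- x) ^+ k) (fun k => - (nu * k%:R + 2 * nu)) n a0).
  have ir := hankel_integrable_resolvent2 x0 a0.
  have := hankelD ir (hankel_integrableZ (- 1) ip).
  rewrite hankelZ// mulN1r => <-.
  apply: hankel_le => //.
  - by rewrite !mulr_ge0// exprn_ge0.
  - exact: hankel_integrableD ir (hankel_integrableZ (- 1) ip).
  - move=> r t ar t0; rewrite rmorphN1 mulN1r.
    exact: sqnorm_resolvent2_sub_ml_partial ax a0 ar t0.
apply/cvgrPdist_le => e e0.
have : (fun n : nat => K * (3 * 2^-1 ^+ n) * C) @ \oo --> K * (3 * 0) * C.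
  apply: cvgM; last exact: cvg_cst; apply: cvgM; first exact: cvg_cst.
  apply: cvgM; first exact: cvg_cst.
  by apply: cvg_expr; rewrite ger0_norm// invf_lt1// ltr1n.
rewrite mulr0 mulr0 mul0r => /cvgrPdist_le/(_ e e0); apply: filterS => n.
rewrite sub0r normrN => h; apply: le_trans (D n) _; apply: le_trans h.
exact: ler_norm.
Qed.

End mittag_leffler_series.

(** * Asymptotics *)

Section mittag_leffler_asymptotics.
Context {R : realType}.
Variable nu : R.
Hypotheses (nu_gt0 : 0 < nu) (nu_lt1 : nu < 1).
Implicit Types (r t x : R).
Notation mu := (@lebesgue_measure R).

(** The integrand is nonnegative, and Gamma does not vanish because [hankel_Gamma] exhibits its
    inverse. *)
Lemma Gamma_fun_gt0 x : 0 < x -> 0 < Gamma_fun x.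
Proof.
move=> x0; rewrite lt_neqAle; apply/andP; split.
  apply/eqP => G0; have := hankel_Gamma x0 (@ltr01 R).
  by rewrite -G0 mul0r => /esym/eqP; rewrite oner_eq0.
by apply: Rintegral_ge0 => t _; rewrite mulr_ge0 ?powR_ge0 ?expR_ge0.
Qed.

Lemma sin_nupi_gt0 : 0 < sin (nu * pi).
Proof. by rewrite sin_gt0_pi// mulr_gt0 ?pi_gt0//= gtr_pMl// pi_gt0. Qed.

(** With w = r^nu, c = cos (nu pi), s = sin (nu pi) and n = w^2 + 2 w c x + x^2, the difference is 2
    w s (x^3 (w c + x) - n^2) / n^2. The numerator has a further factor w and is at most 6 w (w +
    x)^3, while n >= kappa (w + x)^2; then w + x >= x. *)
Lemma spectral_density_sub_le x r : 0 < x ->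
  `|x ^+ 3 * spectral_density nu x r - 2 * sin (nu * pi) * r `^ nu| <=
  12 / (kappa nu ^+ 2 * x) * (r `^ nu) ^+ 2.
Proof.
move=> x0; rewrite spectral_densityE//.
have rp : 0 <= (pi : R) <= pi by rewrite pi_ge0 lexx.
have N := sqnorm_resolvent_ge nu_gt0 nu_lt1 r x0 rp.
have k0 := kappa_gt0 nu_gt0 nu_lt1.
have NE : sqnorm (resolvent nu x r pi) =
    (r `^ nu) ^+ 2 + 2 * r `^ nu * cos (nu * pi) * x + x ^+ 2.
  rewrite /sqnorm /= addr0.
  transitivity ((r `^ nu) ^+ 2 * (cos (nu * pi) ^+ 2 + sin (nu * pi) ^+ 2) +
    2 * r `^ nu * cos (nu * pi) * x + x ^+ 2); first by ring.
  by rewrite cos2Dsin2 mulr1.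
have w0 := powR_ge0 r nu.
have c1 : -1 <= cos (nu * pi) <= 1 by rewrite cos_geN1 cos_le1.
have s1 : `|sin (nu * pi)| <= 1 by rewrite ler_norml sin_geN1 sin_le1.
move: (sqnorm _) (r `^ nu) (cos _) (sin _) (kappa _) N k0 NE w0 c1 s1.
move=> n w c s k N k0 nE w0 c1 s1.
have wx : 0 < w + x by rewrite ltr_wpDl.
have kw : 0 < k * (w + x) ^+ 2 by rewrite mulr_gt0// exprn_gt0.
have n0 : 0 < n by exact: lt_le_trans N.
have -> : x ^+ 3 * (2 * (w * s) * (w * c + x) / n ^+ 2) - 2 * s * w =
    2 * w * s * ((x ^+ 3 * (w * c + x) - n ^+ 2) / n ^+ 2).
  by field; rewrite gt_eqF.
(* As |c| <= 1, the coefficients after division by w are at most 3, 6, 4, 1, against 6, 18, 18, 6 in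
   6 (w + x)^3. *)
have num : `|x ^+ 3 * (w * c + x) - n ^+ 2| <= 6 * w * (w + x) ^+ 3.
  rewrite nE (_ : _ - _ = - (w * (3 * c * x ^+ 3 + (4 * c ^+ 2 + 2) * w * x ^+ 2 + 4 * w ^+ 2 * c * x + w ^+ 3))); last by ring.
  rewrite normrN normrM ger0_norm// (_ : 6 * w * (w + x) ^+ 3 = w * (6 * (w + x) ^+ 3)); last by ring.
  rewrite ler_wpM2l//.
  have x3 : 0 <= x ^+ 3 by rewrite exprn_ge0// ltW.
  have wx2 : 0 <= w * x ^+ 2 by rewrite mulr_ge0// exprn_ge0// ltW.
  have w2x : 0 <= w ^+ 2 * x by rewrite mulr_ge0 ?exprn_ge0// ltW.
  have w3 : 0 <= w ^+ 3 by rewrite exprn_ge0.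
  have /andP[cm1 cp1] := c1.
  have c20 : 0 <= c ^+ 2 by exact: sqr_ge0.
  have c21 : c ^+ 2 <= 1 by nra.
  have a1 := ler_wpM2r x3 cm1; have a2 := ler_wpM2r x3 cp1.
  have a3 := ler_wpM2r w2x cm1; have a4 := ler_wpM2r w2x cp1.
  have a5 := ler_wpM2r wx2 c20; have a6 := ler_wpM2r wx2 c21.
  by rewrite ler_norml; apply/andP; split; lra.
rewrite !normrM (ger0_norm w0) normr_nat normfV [`|n ^+ 2|]ger0_norm ?sqr_ge0//.
have s2 : 2 * w * `|s| <= 2 * w by rewrite ler_piMr// mulr_ge0.
apply: (@le_trans _ _ (2 * w * (6 * w * (w + x) ^+ 3 / n ^+ 2))).
  rewrite ler_pM ?mulr_ge0 ?invr_ge0 ?sqr_ge0//.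
  by rewrite ler_wpM2r ?invr_ge0 ?sqr_ge0.
have n2 : (k * (w + x) ^+ 2) ^+ 2 <= n ^+ 2.
  by rewrite ler_sqr ?nnegrE ?(ltW n0) ?(ltW kw).
have b0 : 0 <= 2 * w * (6 * w * (w + x) ^+ 3).
  by rewrite !(mulr_ge0, exprn_ge0) ?(ltW wx).
apply: (@le_trans _ _ (2 * w * (6 * w * (w + x) ^+ 3) / (k * (w + x) ^+ 2) ^+ 2)).
  by rewrite mulrA ler_wpM2l// lef_pV2 ?posrE ?exprn_gt0.
rewrite (_ : 2 * w * (6 * w * (w + x) ^+ 3) / (k * (w + x) ^+ 2) ^+ 2 =
  12 / (k ^+ 2 * (w + x)) * w ^+ 2); last by field; rewrite !gt_eqF.
rewrite ler_wpM2r ?sqr_ge0// ler_wpM2l// lef_pV2 ?posrE ?mulr_gt0 ?exprn_gt0//.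
by rewrite ler_wpM2l ?sqr_ge0// lerDr.
Qed.

(* E_{nu,2nu}^2(z) *)
Definition ml2 z := limn (pseries (ml_coef nu) z).

Lemma ml2_spectral x : 0 < x ->
  ml2 (- x) = (\int[mu]_(r in `]0, +oo[) (expR (- r) * spectral_density nu x r)) / pi.
Proof. by move=> x0; apply/cvg_lim => //; exact: cvg_pseries_ml. Qed.

Definition ml2_limit : R := 2 * sin (nu * pi) * Gamma_fun (nu + 1) / pi.

Lemma ml2_limit_gt0 : 0 < ml2_limit.
Proof.
by rewrite divr_gt0 ?pi_gt0// !mulr_gt0 ?sin_nupi_gt0 ?Gamma_fun_gt0 ?addr_gt0.
Qed.

(** Multiply [spectral_density_sub_le] by e^-r and integrate: the main term gives 2 sin (nu pi)
    Gamma(nu + 1), the error term a multiple of Gamma(2 nu + 1) / x. *)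
Lemma ml2_asymptotic : exists C, forall x, 0 < x ->
  `|x ^+ 3 * ml2 (- x) - ml2_limit| <= C / x.
Proof.
have n1 : 0 < nu + 1 by rewrite addr_gt0.
have n2 : 0 < 2 * nu + 1 by rewrite addr_gt0 ?mulr_gt0.
pose K := 12 / (kappa nu ^+ 2) : R.
exists (K * Gamma_fun (2 * nu + 1) / pi) => x x0.
have i1 := integrable_gamma n1; have i2 := integrable_gamma n2.
have iS := integrable_spectral nu_gt0 nu_lt1 x0.
have i1' : mu.-integrable `]0, +oo[ (EFin \o (fun r => 2 * sin (nu * pi) * gamma_integrand (nu + 1) r)).
  have := integrableZl (measurable_itvR _) (2 * sin (nu * pi)) i1.
  by apply: eq_integrable => // r _ /=; rewrite EFinM.
have i2' : mu.-integrable `]0, +oo[ (EFin \o (fun r => K / x * gamma_integrand (2 * nu + 1) r)).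
  have := integrableZl (measurable_itvR _) (K / x) i2.
  by apply: eq_integrable => // r _ /=; rewrite EFinM.
have iS' : mu.-integrable `]0, +oo[ (EFin \o (fun r => x ^+ 3 * (expR (- r) * spectral_density nu x r))).
  have := integrableZl (measurable_itvR _) (x ^+ 3) iS.
  by apply: eq_integrable => // r _ /=; rewrite EFinM.
have iD := integrableB (measurable_itvR _) iS' i1'.
have -> : x ^+ 3 * ml2 (- x) - ml2_limit =
   (\int[mu]_(r in `]0, +oo[) (x ^+ 3 * (expR (- r) * spectral_density nu x r) -
      2 * sin (nu * pi) * gamma_integrand (nu + 1) r)) / pi.
  rewrite RintegralB// RintegralZl// RintegralZl// ml2_spectral// mulrA -mulrBl.
  by congr ((_ - _) / _).
have -> : K * Gamma_fun (2 * nu + 1) / pi / x = (K / x * Gamma_fun (2 * nu + 1)) / pi.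
  by rewrite -mulrA [pi^-1 / x]mulrC mulrA [K * _ / x]mulrAC.
rewrite normrM [`|pi^-1|]ger0_norm ?invr_ge0 ?pi_ge0// ler_wpM2r ?invr_ge0 ?pi_ge0//.
have iD' : mu.-integrable `]0, +oo[ (EFin \o (fun r => x ^+ 3 * (expR (- r) * spectral_density nu x r) -
      2 * sin (nu * pi) * gamma_integrand (nu + 1) r)).
  by apply: eq_integrable iD => // r _ /=; rewrite EFinB.
apply: le_trans (le_normr_Rintegral _ iD') _ => //.
rewrite -[X in _ <= _ * X]/(\int[mu]_(r in `]0, +oo[) gamma_integrand (2 * nu + 1) r) -RintegralZl//.
apply: le_Rintegral => //; first exact: integrable_norm.
move=> r /=; rewrite in_itv/= andbT => r0.
have -> : x ^+ 3 * (expR (- r) * spectral_density nu x r) -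
      2 * sin (nu * pi) * gamma_integrand (nu + 1) r =
  expR (- r) * (x ^+ 3 * spectral_density nu x r - 2 * sin (nu * pi) * r `^ nu).
  by rewrite /gamma_integrand addrK; ring.
have -> : K / x * gamma_integrand (2 * nu + 1) r =
  expR (- r) * (12 / (kappa nu ^+ 2 * x) * (r `^ nu) ^+ 2).
  have -> : (r `^ nu) ^+ 2 = r `^ (2 * nu).
    by rewrite -powR_mulrn ?powR_ge0// -powRrM mulrC.
  by rewrite /gamma_integrand addrK /K [(kappa nu ^+ 2 * x)^-1]invfM; ring.
by rewrite normrM ger0_norm ?expR_ge0// ler_wpM2l ?expR_ge0// spectral_density_sub_le.
Qed.

End mittag_leffler_asymptotics.

(** * Power series that converge everywhere *)

Section pseries_entire.
Context {R : realType}.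
Implicit Types (c : nat -> R) (z K : R).

Lemma cvgn_pseries_diffs c : (forall z, cvgn (pseries c z)) ->
  forall z, cvgn (pseries (pseries_diffs c) z).
Proof.
(* The factor 2 absorbs the derivative: n + 1 <= 2^(n+1), so (n+1) |c_(n+1)| |z|^n <= |c_(n+1)|
   K^(n+1). Convergence at K + 1 makes the series at K absolutely convergent. *)
move=> cc z; pose K := 2 * (`|z| + 1).
have z1 : 0 <= `|z| + 1 by rewrite addr_ge0.
have K0 : 0 <= K by rewrite mulr_ge0.
have H : cvgn (pseries (fun i => `|c i|) K).
  apply: (@is_cvg_pseries_inside_norm _ _ (K + 1)) => //.
  by rewrite !ger0_norm ?addr_ge0// ltrDl.
apply: normed_cvg.
apply: (@series_le_cvg _ _ (fun n => `|c n.+1| * K ^+ n.+1)).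
- by move=> n /=.
- by move=> n; rewrite mulr_ge0// exprn_ge0.
- move=> n /=; rewrite /pseries_diffs !normrM normr_nat normrX mulrAC [leRHS]mulrC ler_wpM2r//.
  rewrite /K exprMn ler_pM ?exprn_ge0//.
    by rewrite -natrX ler_nat ltnW// ltn_expl.
  rewrite exprS; apply: (@le_trans _ _ ((`|z| + 1) ^+ n)).
    by rewrite lerXn2r ?nnegrE// lerDl.
  by rewrite ler_peMl ?exprn_ge0// lerDr.
- move: H; rewrite /pseries => /cvg_ex[l Hl]; apply/cvg_ex; exists (l - `|c 0%N|).
  have := Hl; rewrite -(cvg_shiftS _) => Hl'.
  have -> : series (fun n => `|c n.+1| * K ^+ n.+1) =
     (fun n => series (fun i => `|c i| * K ^+ i) n.+1 - `|c 0%N|).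
    apply/funext => n; rewrite /series/= big_nat_recl//= expr0 mulr1 addrC addKr.
    by [].
  by apply: cvgB => //; exact: cvg_cst.
Qed.

(** Continuity is read off termwise differentiability, which takes the convergence of the first two
    formal derivatives as hypotheses. *)
Lemma continuous_pseries c : (forall z, cvgn (pseries c z)) ->
  continuous (fun z => limn (pseries c z)).
Proof.
move=> cc z.
have c1 := cvgn_pseries_diffs cc; have c2 := cvgn_pseries_diffs c1.
have zK : `|z| < `| `|z| + 1 | by rewrite [ltRHS]ger0_norm ?addr_ge0// ltrDl.
exact: is_derive_continuous (pseries_snd_diffs (cc _) (c1 _) (c2 _) zK).
Qed.

Lemma limn_pseries0 c : limn (pseries c 0) = c 0%N.
Proof.
(* The partial sum of index 0 is empty; the sequence is constant only from index 1 on. *)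
apply/cvg_lim => //; rewrite -(cvg_shiftS _).
rewrite (_ : (fun n => _) = (fun=> c 0%N)); first exact: cvg_cst.
apply/funext => n; rewrite /pseries /series/= big_nat_recl//= expr0 mulr1.
by rewrite big1 ?addr0// => i _; rewrite expr0n mulr0.
Qed.

End pseries_entire.

(** * Behaviour of the density at infinity and at 0 *)

Section interarrival.
Context {R : realType}.
Variables nu lambda : R.
Hypotheses (nu_gt0 : 0 < nu) (nu_lt1 : nu < 1) (lambda_gt0 : 0 < lambda).
Implicit Types (r t x : R).
Notation mu := (@lebesgue_measure R).

(** [cvg_pseries_ml] gives convergence at every negative point, hence in discs of every radius, with
    no estimate on the growth of Gamma. *)
Lemma cvgn_pseries_ml z : cvgn (pseries (ml_coef nu) z).
Proof.
have x0 : 0 < `|z| + 1 by rewrite ltr_wpDl.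
apply: (@is_cvg_pseries_inside _ _ (- (`|z| + 1))).
  by apply/cvg_ex; eexists; exact: (cvg_pseries_ml nu_gt0 nu_lt1 x0).
by rewrite normrN [ltRHS]ger0_norm ?(ltW x0)// ltrDl.
Qed.

Lemma continuous_ml2 : continuous (@ml2 R nu).
Proof. by apply: continuous_pseries; exact: cvgn_pseries_ml. Qed.

Lemma ml2_0 : ml2 nu 0 = (Gamma_fun (2 * nu))^-1.
Proof.
rewrite /ml2 limn_pseries0 /ml_coef mulr0 add0r /pochhammer big_geq//.
by rewrite fact0 !mul1r.
Qed.

Lemma interarrival_densityE t : interarrival_density lambda nu t =
  lambda ^+ 2 * t `^ (2 * nu - 1) * ml2 nu (- (lambda * t `^ nu)).
Proof. by rewrite /interarrival_density mulNr. Qed.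

Definition tail_equiv t := sin (nu * pi) / pi *
  (2 * Gamma_fun (nu + 1) / (lambda * t `^ (nu + 1))).

Lemma tail_equivE t : tail_equiv t = ml2_limit nu / (lambda * t `^ (nu + 1)).
Proof. by rewrite /tail_equiv /ml2_limit; ring. Qed.

(** The powers combine as t^(2 nu - 1) t^(nu + 1) = (t^nu)^3 and lambda^2 lambda = lambda^3, so
    everything depends on x = lambda t^nu and [ml2_asymptotic] applies. *)
Lemma interarrival_ratioE t : 0 < t ->
  interarrival_density lambda nu t / tail_equiv t =
  (lambda * t `^ nu) ^+ 3 * ml2 nu (- (lambda * t `^ nu)) / ml2_limit nu.
Proof.
move=> t0; rewrite interarrival_densityE tail_equivE.
have L0 := ml2_limit_gt0 nu_gt0 nu_lt1.
have -> : t `^ (2 * nu - 1) = (t `^ nu) ^+ 2 / t.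
  rewrite powRB ?powRr1 ?(ltW t0)//; last by apply/implyP; rewrite (gt_eqF t0).
  by rewrite -powR_mulrn ?powR_ge0// -powRrM [nu * _]mulrC.
have -> : t `^ (nu + 1) = t `^ nu * t.
  by rewrite powRD ?powRr1 ?(ltW t0)//; apply/implyP; rewrite (gt_eqF t0).
have w0 := powR_gt0 nu t0.
move: (ml2 _ _) => m.
move: (ml2_limit _) (t `^ nu) L0 w0 => l w l0 w0.
by field; rewrite !gt_eqF.
Qed.

Lemma near_pinfty_powR (a M : R) : 0 < a -> \forall t \near +oo%R, M <= t `^ a.
Proof.
move=> a0; near=> t.
have Mt : (`|M| + 1) `^ a^-1 <= t by near: t; apply: nbhs_pinfty_ge; exact: num_real.
have M1 : 0 <= `|M| + 1 by rewrite addr_ge0.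
apply: (@le_trans _ _ (((`|M| + 1) `^ a^-1) `^ a)).
  rewrite -powRrM mulVf ?gt_eqF// powRr1//.
  by rewrite (le_trans (ler_norm M))// lerDl.
apply: ge0_ler_powR; rewrite ?nnegrE ?powR_ge0 ?(ltW a0)//.
Unshelve. all: by end_near. Qed.

Lemma interarrival_tail :
  asymp_equiv (pinfty_nbhs R) (interarrival_density lambda nu) tail_equiv.
Proof.
have [C HC] := ml2_asymptotic nu_gt0 nu_lt1.
have L0 := ml2_limit_gt0 nu_gt0 nu_lt1.
rewrite /asymp_equiv; apply/cvgrPdist_le => e e0; near=> t.
have t0 : 0 < t by near: t; apply: nbhs_pinfty_gt; exact: num_real.
have w0 := powR_gt0 nu t0.
have x0 : 0 < lambda * t `^ nu by rewrite mulr_gt0.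
rewrite interarrival_ratioE// distrC -[X in _ - X](divff (lt0r_neq0 L0)) -mulrBl normrM.
rewrite [`|_^-1|]ger0_norm ?invr_ge0 ?(ltW L0)// ler_pdivrMr//.
apply: le_trans (HC _ x0) _; rewrite ler_pdivrMr//.
(* The threshold at which the error C / x of [ml2_asymptotic] falls below e times the limit. *)
have wt : `|C| / (e * ml2_limit nu * lambda) <= t `^ nu.
  by near: t; exact: near_pinfty_powR.
move: wt; rewrite (ler_pdivrMr _ _ (mulr_gt0 (mulr_gt0 e0 L0) lambda_gt0)) => h.
apply: le_trans (ler_norm _) _; apply: le_trans h _.
by rewrite [leLHS]mulrC -!mulrA.
Unshelve. all: by end_near. Qed.

(** Reflection replaces pi / sin (nu pi) by Gamma(nu) Gamma(1 - nu), and Gamma(nu) cancels against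
    Gamma(nu + 1) = nu Gamma(nu). *)
Lemma tail_equiv_Gamma t : 0 < t ->
  tail_equiv t = 2 * nu / (lambda * Gamma_fun (1 - nu) * t `^ (nu + 1)).
Proof.
move=> t0; rewrite /tail_equiv Gamma_funS//.
have H := Gamma_fun_reflection nu_gt0 nu_lt1.
have G1 : 0 < Gamma_fun (1 - nu) by rewrite Gamma_fun_gt0// subr_gt0.
have w0 := powR_gt0 (nu + 1) t0.
have p0 := pi_gt0 R.
rewrite -[X in _ / X]H.
have G0 := Gamma_fun_gt0 nu_gt0; have s0 := sin_nupi_gt0 nu_gt0 nu_lt1.
move: (sin _) (Gamma_fun nu) (Gamma_fun (1 - nu)) (t `^ _) G1 w0 G0 s0 => s g g' w *.
by field; rewrite !gt_eqF.
Qed.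

Lemma interarrival_head :
  asymp_equiv (0^'+) (interarrival_density lambda nu)
    (fun t => lambda ^+ 2 * t `^ (2 * nu - 1) / Gamma_fun (2 * nu)).
Proof.
have n2 : 0 < 2 * nu by rewrite mulr_gt0.
have G0 := Gamma_fun_gt0 n2.
rewrite /asymp_equiv.
have L : ml2 nu (- (lambda * t `^ nu)) * Gamma_fun (2 * nu) @[t --> 0^'+] --> (1 : R).
  rewrite -[X in _ --> X](mulVf (lt0r_neq0 G0)) -ml2_0.
  apply: cvgM; last exact: cvg_cst.
  apply: continuous_cvg; first exact: continuous_ml2.
  rewrite -[X in _ --> X]oppr0 -[X in _ --> - X](mulr0 lambda).
  by apply: cvgN; apply: cvgM; [exact: cvg_cst|exact: powR_cvg0].
apply: cvg_trans L; apply: near_eq_cvg; near=> t.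
have t0 : 0 < t by near: t; exact: nbhs_right_gt.
rewrite interarrival_densityE.
have w0 := powR_gt0 (2 * nu - 1) t0.
by field; rewrite !gt_eqF.
Unshelve. all: by end_near. Qed.

End interarrival.

(** * The infinite mean *)

Section infinite_mean.
Context {R : realType}.
Variables nu lambda : R.
Hypotheses (nu_gt0 : 0 < nu) (nu_lt1 : nu < 1) (lambda_gt0 : 0 < lambda).
Implicit Types (r t x : R).
Notation mu := (@lebesgue_measure R).

Let g t := t * interarrival_density lambda nu t.

Let gE t : 0 < t -> g t = lambda ^+ 2 * t `^ (2 * nu) * ml2 nu (- (lambda * t `^ nu)).
Proof.
move=> t0; rewrite /g interarrival_densityE//.
rewrite powRB ?powRr1 ?(ltW t0)//; last by apply/implyP; rewrite (gt_eqF t0).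
by move: (ml2 _ _) => m; field; rewrite gt_eqF.
Qed.

Let continuous_g t : 0 < t -> {for t, continuous g}.
Proof.
move=> t0; rewrite (_ : g = fun t => t * (lambda ^+ 2 * t `^ (2 * nu - 1) * ml2 nu (- (lambda * t `^ nu)))).
  apply: cvgM; first exact: cvg_id.
  apply: cvgM.
    by apply: cvgM; [exact: cvg_cst|exact: continuous_powR].
  apply: (@continuous_comp _ _ _ (fun t => - (lambda * t `^ nu)) (ml2 nu)).
    by apply: cvgN; apply: cvgM; [exact: cvg_cst|exact: continuous_powR].
  exact: continuous_ml2.
by apply/funext => s; rewrite /g interarrival_densityE.
Qed.

(** Tolerance 1/2 in [interarrival_tail] keeps half of the equivalent as a lower bound, hence the 2
    in c = [ml2_limit nu / (2 * lambda)]; the factor t raises the exponent from - nu - 1 to - nu. *)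
Let g_tail : exists T c, [/\ 0 < T, 0 < c & forall t, T <= t -> c * t `^ (- nu) <= g t].
Proof.
have L0 := ml2_limit_gt0 nu_gt0 nu_lt1.
have /cvgrPdist_le/(_ 2^-1) := interarrival_tail nu_gt0 nu_lt1 lambda_gt0.
rewrite invr_gt0 ltr0n => /(_ isT)[M [_ MH]].
exists (`|M| + 1), (ml2_limit nu / (2 * lambda)); split.
- by rewrite ltr_wpDl.
- by rewrite divr_gt0// mulr_gt0.
move=> t Mt; have t0 : 0 < t by apply: lt_le_trans Mt; rewrite ltr_wpDl.
have := MH t; rewrite /= => /(_ (lt_le_trans _ Mt)).
have -> : M < `|M| + 1 by rewrite (le_lt_trans (ler_norm M))// ltrDl.
move=> /(_ isT); rewrite tail_equivE ler_distlC => /andP[+ _].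
have w0 := powR_gt0 nu t0.
have tE : t `^ (nu + 1) = t `^ nu * t.
  by rewrite powRD ?powRr1 ?(ltW t0)//; apply/implyP; rewrite (gt_eqF t0).
have d0 : 0 < ml2_limit nu / (lambda * t `^ (nu + 1)).
  by rewrite tE divr_gt0// !mulr_gt0.
rewrite ler_pdivlMr// => h; rewrite /g; apply: le_trans (ler_wpM2l (ltW t0) h).
rewrite tE powRN; move: (t `^ nu) (ml2_limit nu) w0 L0 => w l w0 l0.
rewrite (_ : t * _ = l / (2 * lambda) / w)//.
by field; rewrite !gt_eqF.
Qed.

(** The factor t removes the singularity, t t^(2 nu - 1) = t^(2 nu), and [ml2] is bounded on the
    compact range of - lambda t^nu. *)
Let g_head T : 0 < T -> exists2 M, 0 <= M & forall t, 0 < t -> t <= T -> `|g t| <= M.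
Proof.
move=> T0.
have : compact (ml2 nu @` `[- (lambda * T `^ nu), 0]).
  apply: continuous_compact; last exact: segment_compact.
  apply: continuous_subspaceT => z; exact: continuous_ml2.
move=> /compact_bounded[B [_ HB]].
have n0 : 0 <= 2 * nu by rewrite mulr_ge0// ltW.
exists (lambda ^+ 2 * T `^ (2 * nu) * (`|B| + 1)).
  by rewrite !mulr_ge0 ?powR_ge0 ?(ltW lambda_gt0)// addr_ge0.
move=> t t0 tT; rewrite gE// normrM [`|_ * t `^ _|]ger0_norm; last by rewrite mulr_ge0 ?powR_ge0 ?sqr_ge0.
have mono p : 0 <= p -> t `^ p <= T `^ p.
  by move=> p0; apply: ge0_ler_powR; rewrite ?nnegrE ?(ltW t0) ?(ltW T0).
have l2 : 0 <= lambda ^+ 2 by exact: sqr_ge0.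
apply: ler_pM => //; first by rewrite mulr_ge0 ?powR_ge0.
  by rewrite ler_wpM2l// mono.
apply: (HB (`|B| + 1)); first by rewrite (le_lt_trans (ler_norm B))// ltrDl.
exists (- (lambda * t `^ nu)) => //; rewrite /= in_itv/= lerN2 oppr_le0.
by rewrite mulr_ge0 ?powR_ge0 ?(ltW lambda_gt0)// andbT ler_wpM2l ?(ltW lambda_gt0)// mono// ltW.
Qed.

(** The sign of the density is known only beyond T, by [g_tail]. So the negative part lives on (0,
    T], where [g_head] makes its integral finite, and it is the positive part whose integral is
    shown to exceed every K. *)
Lemma interarrival_mean :
  (\int[mu]_(t in `]0%R, +oo[) (t * interarrival_density lambda nu t)%:E = +oo)%E.
Proof.
have [T [c [T0 c0 gT]]] := g_tail.
have [M M0 gM] := g_head T0.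
have mg : measurable_fun (`]0, +oo[%classic : set (measurableTypeR R)) (EFin \o g).
  by apply/measurable_EFinP; exact: measurable_continuous_gt0 continuous_g.
rewrite -[LHS]/(\int[mu]_(t in `]0%R, +oo[) (EFin \o g) t)%E integralE.
have neg_lt : (\int[mu]_(t in `]0%R, +oo[) ((EFin \o g)^\- t) < +oo)%E.
  apply: (@le_lt_trans _ _ (\int[mu]_(t in `]0%R, +oo[) (M * \1_(`]0%R, T]%classic : set (measurableTypeR R)) t)%:E)%E).
    apply: ge0_le_integral.
    - exact: measurable_itvR.
    - by move=> t _; exact: funeneg_ge0.
    - exact: measurable_funeneg.
    - apply/measurable_EFinP; apply: measurable_funM; first exact: measurable_cst.
      exact: (@measurable_indic _ (measurableTypeR R) R _ _ (measurable_itvR _)).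
    - move=> t /=; rewrite in_itv/= andbT => t0.
      rewrite funenegE /= ge_max; have [tT|Tt] := leP t T.
        rewrite indicE mem_set ?mulr1; last by rewrite /= in_itv/= t0.
        by apply/andP; split; rewrite lee_fin// (le_trans (ler_norm _))// normrN gM.
      have gt0' : 0 <= g t.
        by apply: le_trans (gT _ (ltW Tt)); rewrite mulr_ge0 ?powR_ge0// ltW.
      by apply/andP; split; rewrite lee_fin ?mulr_ge0// (@le_trans _ _ 0) ?oppr_le0// mulr_ge0.
  under eq_integral do rewrite EFinM.
  rewrite ge0_integralZl_EFin//; last first.
    apply/measurable_EFinP.
    exact: (@measurable_indic _ (measurableTypeR R) R _ _ (measurable_itvR _)).
  rewrite integral_indic//.
  apply: (@le_lt_trans _ _ (M%:E * mu `]0%R, T])%E).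
    rewrite lee_wpmul2l ?lee_fin// le_measure ?inE//.
    by apply: measurableI; exact: measurable_itvR.
  by rewrite lebesgue_measure_itv/= lte_fin T0 -EFinB -EFinM ltry.
have pos_y : (\int[mu]_(t in `]0%R, +oo[) ((EFin \o g)^\+ t) = +oo)%E.
  apply: eq_infty => K.
  (* Taking n >= 2 T gives n - T >= n/2, and n^(1 - nu) >= 2 K / c then suffices; such n exist
     because nu < 1. *)
  have [n [Tn nK]] : exists n : R, T < n /\ K <= c * n `^ (- nu) * (n - T).
    have : \forall n \near +oo%R, 2 * K / c <= n `^ (1 - nu) /\ 2 * T <= n.
      near=> n; split; first by near: n; apply: near_pinfty_powR; rewrite subr_gt0.
      by near: n; apply: nbhs_pinfty_ge; exact: num_real.
    move=> /filter_ex[n [h Tn]]; exists n; split; first by lra.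
    have nn0 : 0 < n by lra.
    have w0 := powR_gt0 (- nu) nn0.
    move: h; rewrite ler_pdivrMr// powRD; last by apply/implyP; rewrite (gt_eqF nn0).
    rewrite powRr1 ?(ltW nn0)// => h.
    have cw : 0 <= c * n `^ (- nu) by rewrite mulr_ge0// ltW.
    have := ler_wpM2l cw Tn; nra.
  apply: (@le_trans _ _ (\int[mu]_(t in `[T, n]) (EFin \o g)^\+ t)%E); last first.
    apply: ge0_subset_integral.
    - exact: measurable_itvR.
    - exact: measurable_itvR.
    - exact: measurable_funepos.
    - by move=> t _; exact: funepos_ge0.
    - by move=> t /=; rewrite !in_itv/= andbT => /andP[Tt _]; exact: lt_le_trans Tt.
  (* On [T, n] the decreasing bound c t^-nu is replaced by its value at n, so that only a constant
     is integrated. *)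
  apply: (@le_trans _ _ (\int[mu]_(t in `[T, n]) (c * n `^ (- nu))%:E)%E).
    rewrite integral_cst//= lebesgue_measure_itv/= lte_fin Tn -EFinB -EFinM lee_fin//.
  apply: ge0_le_integral.
  - exact: measurable_itvR.
  - by move=> t _; rewrite lee_fin mulr_ge0 ?powR_ge0// ltW.
  - exact: measurable_cst.
  - apply: (measurable_funS _ _ (measurable_funepos mg)); first exact: measurable_itvR.
    by move=> t /=; rewrite !in_itv/= andbT => /andP[Tt _]; exact: lt_le_trans Tt.
  - move=> t /=; rewrite in_itv/= => /andP[Tt tn].
    rewrite funeposE /= le_max lee_fin; apply/orP; left.
    apply: le_trans (gT _ Tt); rewrite ler_wpM2l ?(ltW c0)// !powRN.
    have t0 := lt_le_trans T0 Tt; have nn0 := lt_le_trans t0 tn.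
    rewrite lef_pV2 ?posrE ?powR_gt0//.
    by apply: ge0_ler_powR; rewrite ?nnegrE ?(ltW nu_gt0) ?(ltW t0) ?(ltW nn0).
rewrite pos_y addye//; move: neg_lt; case: (X in (X < _)%E -> _) => //.
Unshelve. all: by end_near. Qed.
End infinite_mean.

Theorem mainTheorem6 (R : realType) (lambda nu : R)
    (lambda_gt0 : 0 < lambda) (nu_gt0 : 0 < nu) (nu_lt1 : nu < 1) :
  [/\ asymp_equiv (pinfty_nbhs R) (interarrival_density lambda nu)
        (fun t => sin (nu * pi) / pi *
                  (2 * Gamma_fun (nu + 1) / (lambda * t `^ (nu + 1)))),
      (forall t : R, 0 < t ->
        sin (nu * pi) / pi *
          (2 * Gamma_fun (nu + 1) / (lambda * t `^ (nu + 1))) =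
        2 * nu / (lambda * Gamma_fun (1 - nu) * t `^ (nu + 1))),
      (\int[lebesgue_measure]_(t in `]0%R, +oo[)
         (t * interarrival_density lambda nu t)%:E = +oo)%E &
      asymp_equiv (0^'+) (interarrival_density lambda nu)
        (fun t => lambda ^+ 2 * t `^ (2 * nu - 1) / Gamma_fun (2 * nu))].
Proof.
split.
- exact: interarrival_tail.
- exact: tail_equiv_Gamma.
- exact: interarrival_mean.
- exact: interarrival_head.
Qed.
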